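(* Let $\lambda,\mu$ be partitions with nonnegative parts and at most $n$ parts, $T\in B_\lambda$, $U\in B_\mu$. Then $R(T,U)$ is a Gelfand–Tsetlin pattern, i.e. a tableau of shape $\lambda$, and the connected component of $B_\lambda\otimes B_\mu$ containing $T\otimes U$ has highest weight element $R(T,U)\otimes b_\mu$; moreover $T\otimes U$ is the $J(T\star U)$-element of that component, i.e. $T\otimes U=J(T\star U)[R(T,U)\otimes b_\mu]$.
   Context: Crystals: a $\mathfrak{gl}_n$-crystal is a finite set with $\mathrm{wt}$, $\varepsilon_i,\varphi_i$, $e_i,f_i:B\to B\sqcup\{0\}$ ($1\le i\le n-1$); tensor product on $A\times B$: $\mathrm{wt}(a\otimes b)=\mathrm{wt}(a)+\mathrm{wt}(b)$, $e_i(a\otimes b)=e_ia\otimes b$ if $\varepsilon_i(a)>\varphi_i(b)$, else $a\otimes e_ib$; $f_i(a\otimes b)=f_ia\otimes b$ if $\varepsilon_i(a)\ge\varphi_i(b)$, else $a\otimes f_ib$. Components are those of the graph $b$—$e_ib$; a highest weight element is one killed by all $e_i$. $B_\lambda$ is the set of semistandard tableaux of shape $\lambda$ with entries in $\{1,\dots,n\}$, weight $(\#1\text{s},\dots,\#n\text{s})$, with $h_i(j)=\#\{i+1\text{ in columns}\ge j\}-\#\{i\text{ in columns}\ge j\}$ ($h_i(\infty)=0$), $k_i(j)=\#\{i\text{ in columns}\le j\}-\#\{i+1\text{ in columns}\le j\}$ ($k_i(-\infty)=0$); $e_iT$ changes the $i+1$ in the largest column maximizing $h_i$ to $i$ ($0$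 if this column is $\infty$), $f_iT$ changes the $i$ in the smallest column maximizing $k_i$ to $i+1$ ($0$ if $-\infty$); $\varepsilon_i=\max h_i$, $\varphi_i=\max k_i$. $b_\mu\in B_\mu$ has only entries $r$ in row $r$. If $b$ is a highest weight element of weight $\nu$ of a crystal whose component through $b$ is isomorphic to $B_\nu$, there is a unique isomorphism $B_\nu\to$ (that component), sending $b_\nu$ to $b$; for $V\in B_\nu$, $V[b]$ denotes the image of $V$. $T\star U$ is the skew tableau with $U$ placed up and to the right of $T$ (rows $1..n$: row $r$ of $U$ in columns $\lambda_1+1,\dots,\lambda_1+\mu_r$; rows $n+1..2n$: row $r$ of $T$ in columns $1,\dots,\lambda_r$); $J(X)$ is the jeu de taquin rectification of a skew tableau $X$. Tableaux are identified with Gelfand–Tsetlin patterns by $T(i,j)=\#\{\text{entries}\le i\text{ in row }j\}$. Define $J^n=T$ and $J^{k-1}=((J^k\leftarrow a_1)\leftarrow\cdots)\leftarrow a_l$ where $a_1\le\dots\le a_l$ are the entries of row $k$ of $U$ and $\leftarrow$ is row insertion; let $\lambda^k$ be the shape of $J^k$; $R(T,U)(i,j)=\sum_{r\ge j}\lambda^{i-j+1}_r-\sum_{r\ge j+1}\lambda^{i-j}_r$ for $1\le j\le i\le n$. *)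

(* Defs.v *)
From mathcomp Require Import all_boot all_order all_algebra.

Set Implicit Arguments.
Unset Strict Implicit.
Unset Printing Implicit Defensive.

Import Order.TTheory GRing.Theory Num.Theory.

(* Letters and rows are 0-based ordinals: k : 'I_n is the letter (or row)     *)
(* k+1, and i : 'I_n.-1 is the crystal index i+1. The arrays gt and Rarray    *)
(* below keep 1-based indices.                                                *)

(** * Crystals *)

Record crystal (n : nat) := Crystal {
  carrier :> finType;
  wt  : carrier -> {ffun 'I_n -> int};
  eps : 'I_n.-1 -> carrier -> int;
  phi : 'I_n.-1 -> carrier -> int;
  e_  : 'I_n.-1 -> carrier -> option carrier;  (* None is the element 0 *)
  f_  : 'I_n.-1 -> carrier -> option carrier }.

Section Crystals.
Variable n : nat.
Implicit Types A B : crystal n.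

(* eps and phi are the usual ones for this tensor product convention: with    *)
(* <wt, alpha_i> = phi_i - eps_i they are the numbers of times that e_i, f_i  *)
(* can be applied to a (x) b.                                                 *)
Definition tensor A B : crystal n :=
  @Crystal n (A * B)%type
    (fun x => [ffun k => (wt x.1 k + wt x.2 k)%R])
    (fun i x => Num.max (eps i x.2) (eps i x.1 - phi i x.2 + eps i x.2)%R)
    (fun i x => Num.max (phi i x.1) (phi i x.2 - eps i x.1 + phi i x.1)%R)
    (fun i x => if (phi i x.2 < eps i x.1)%R
                then omap (fun a => (a, x.2)) (e_ i x.1)
                else omap (fun b => (x.1, b)) (e_ i x.2))
    (fun i x => if (phi i x.2 <= eps i x.1)%R
                then omap (fun a => (a, x.2)) (f_ i x.1)
                else omap (fun b => (x.1, b)) (f_ i x.2)).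

Definition crystal_edge B : rel B :=
  [rel x y | [exists i, (e_ i x == Some y) || (e_ i y == Some x)]].

Definition same_component B : rel B := connect (@crystal_edge B).

Definition highest_weight B (b : B) : bool := [forall i, e_ i b == None].

Definition iso_onto_component A B (b : B) (psi : {ffun A -> B}) : bool :=
  [&& injectiveb psi,
      [forall y, (y \in codom psi) == same_component b y],
      [forall a, wt (psi a) == wt a],
      [forall i, forall a,
        (eps i (psi a) == eps i a) && (phi i (psi a) == phi i a)] &
      [forall i, forall a,
        (e_ i (psi a) == omap psi (e_ i a)) &&
        (f_ i (psi a) == omap psi (f_ i a))]].

End Crystals.

(** * Semistandard tableaux *)

Section Tableaux.
Variable n : nat.
Implicit Types lam mu nu : n.-tuple nat.

Definition cell lam := {r : 'I_n & 'I_(tnth lam r)}.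
Definition row_of lam (x : cell lam) : 'I_n := tag x.
Definition col_of lam (x : cell lam) : nat := tagged x.

Definition semistandard lam (t : {ffun cell lam -> 'I_n}) : bool :=
  [forall x, forall y,
    (((row_of x == row_of y) && (col_of x <= col_of y)) ==> (t x <= t y)) &&
    (((row_of x < row_of y) && (col_of x == col_of y)) ==> (t x < t y))].

Definition tab lam := {t : {ffun cell lam -> 'I_n} | semistandard t}.

(* Length of the first row; all columns are < width lam. *)
Definition width lam : nat := nth 0 lam 0.

Definition shape_weight lam : {ffun 'I_n -> int} :=
  [ffun r => Posz (tnth lam r)].

Definition tab_wt lam (T : tab lam) : {ffun 'I_n -> int} :=
  [ffun a => Posz #|[set x | val T x == a]|].

Lemma lo_proof (i : 'I_n.-1) : i < n.
Proof. exact: leq_trans (ltn_ord i) (leq_pred n). Qed.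

Lemma hi_proof (i : 'I_n.-1) : i.+1 < n.
Proof. by case: n i => [[]|m i] //=; rewrite ltnS. Qed.

Definition lo (i : 'I_n.-1) : 'I_n := Ordinal (lo_proof i).
Definition hi (i : 'I_n.-1) : 'I_n := Ordinal (hi_proof i).

Section Operators.
Variable lam : n.-tuple nat.
Implicit Types (T : tab lam) (i : 'I_n.-1) (j : nat).

Definition count_ge T (a : 'I_n) j : int :=
  Posz #|[set x | (val T x == a) && (j <= col_of x)]|.
Definition count_le T (a : 'I_n) j : int :=
  Posz #|[set x | (val T x == a) && (col_of x <= j)]|.

Definition hfun T i j : int := (count_ge T (hi i) j - count_ge T (lo i) j)%R.
Definition kfun T i j : int := (count_le T (lo i) j - count_le T (hi i) j)%R.

(* The initial value 0 of the maxima is h_i(oo), resp. k_i(-oo). *)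
Definition tab_eps i T : int := (\big[Num.max/0]_(j < width lam) hfun T i j)%R.
Definition tab_phi i T : int := (\big[Num.max/0]_(j < width lam) kfun T i j)%R.

(* For a partition lam, the recoloured fillings used below are always         *)
(* semistandard, so that insub is never None there.                           *)
Definition recolor j (a b : 'I_n) T : option (tab lam) :=
  insub [ffun x => if (col_of x == j) && (val T x == a) then b else val T x].

(* The largest maximizing column of h_i is finite iff the maximum is > 0. *)
Definition tab_e i T : option (tab lam) :=
  if [pick j : 'I_(width lam) |
        [&& (0 < tab_eps i T)%R, hfun T i j == tab_eps i T &
            [forall j' : 'I_(width lam),
               (hfun T i j' == tab_eps i T) ==> (j' <= j)]]] is Some j
  then recolor j (hi i) (lo i) T else None.

Definition tab_f i T : option (tab lam) :=
  if [pick j : 'I_(width lam) |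
        [&& (0 < tab_phi i T)%R, kfun T i j == tab_phi i T &
            [forall j' : 'I_(width lam),
               (kfun T i j' == tab_phi i T) ==> (j <= j')]]] is Some j
  then recolor j (lo i) (hi i) T else None.

Definition tab_crystal : crystal n :=
  @Crystal n (tab lam) (@tab_wt lam) tab_eps tab_phi tab_e tab_f.

Lemma hw_filling_semistandard : semistandard [ffun x : cell lam => row_of x].
Proof.
apply/forallP => x; apply/forallP => y; rewrite !ffunE.
by apply/andP; split; apply/implyP => /andP[] // /eqP->.
Qed.

Definition hw_tab : tab lam := 
  exist (fun t => semistandard t) _ hw_filling_semistandard.

End Operators.

(* V[b]; it is None when there is no isomorphism from B_nu onto the component *)
(* of b sending b_nu to b.                                                    *)
Definition bracket nu (B : crystal n) (V : tab nu) (b : B) : option B :=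
  omap (fun psi : {ffun tab_crystal nu -> B} => psi V)
    [pick psi : {ffun tab_crystal nu -> B} |
       iso_onto_component b psi && (psi (hw_tab nu) == b)].

(** * Gelfand-Tsetlin patterns *)

Definition gt lam (T : tab lam) (i j : nat) : int :=
  Posz #|[set x | (val T x < i) && ((row_of x).+1 == j)]|.

Definition gt_pattern lam (a : nat -> nat -> int) : Prop :=
  (forall r : 'I_n, a n r.+1 = Posz (tnth lam r)) /\
  (forall i j, 1 <= j <= i -> i < n ->
     (a i.+1 j.+1 <= a i j)%R /\ (a i j <= a i.+1 j)%R).

(** * Row insertion and the array R(T, U) *)

Fixpoint row_insert (t : seq (seq nat)) (a : nat) : seq (seq nat) :=
  if t is row :: t' then
    let p := find (fun x => a < x) row in
    if p < size row
    then set_nth 0 row p a :: row_insert t' (nth 0 row p)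
    else rcons row a :: t'
  else [:: [:: a]].

Definition rows lam (T : tab lam) : seq (seq nat) :=
  [seq [seq nat_of_ord (val T (Tagged (fun r => 'I_(tnth lam r)) c))
          | c <- enum 'I_(tnth lam r)]
     | r <- enum 'I_n].

(* J^k: the rows n, n-1, ..., k+1 of U are inserted into T, in that order. *)
Definition Jtab lam mu (T : tab lam) (U : tab mu) (k : nat) : seq (seq nat) :=
  foldr (fun row t => foldl row_insert t row) (rows T) (drop k (rows U)).

Definition Jshape lam mu (T : tab lam) (U : tab mu) (k : nat) : seq nat :=
  map size (Jtab T U k).

Definition Rarray lam mu (T : tab lam) (U : tab mu) (i j : nat) : int :=
  (Posz (sumn (drop j.-1 (Jshape T U (i - j).+1)))
   - Posz (sumn (drop j (Jshape T U (i - j)))))%R.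

(** * Jeu de taquin *)

(* A filling gives the entry in each row and column (both 0-based); None      *)
(* means that there is no entry.                                              *)
Definition filling := nat -> nat -> option nat.

Definition tab_filling lam (T : tab lam) : filling := fun r c =>
  if insub r is Some r' then
    if (insub c : option 'I_(tnth lam r')) is Some c'
    then Some (nat_of_ord (val T (Tagged (fun r => 'I_(tnth lam r)) c')))
    else None
  else None.

Definition star_filling lam mu (T : tab lam) (U : tab mu) : filling :=
  fun r c =>
    if r < n then (if width lam <= c then tab_filling U r (c - width lam)
                   else None)
    else tab_filling T (r - n) c.

(* The row lengths of the inner shape of T * U. *)
Definition star_inner lam : nat -> nat := fun r => if r < n then width lam else 0.

End Tableaux.

Definition move_entry (F : filling) (r c r' c' : nat) : filling :=
  fun p q => if (p == r) && (q == c) then F r' c'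
             else if (p == r') && (q == c') then None else F p q.

(* slide F r c F': sliding into the empty cell (r, c) of F until neither the  *)
(* right nor the lower neighbour of the hole is occupied gives F'.            *)
Inductive slide : filling -> nat -> nat -> filling -> Prop :=
| slide_stop F r c :
    F r c.+1 = None -> F r.+1 c = None -> slide F r c F
| slide_right F r c x F' :
    F r c.+1 = Some x -> (forall y, F r.+1 c = Some y -> x < y) ->
    slide (move_entry F r c r c.+1) r c.+1 F' -> slide F r c F'
| slide_up F r c y F' :
    F r.+1 c = Some y -> (forall x, F r c.+1 = Some x -> y <= x) ->
    slide (move_entry F r c r.+1 c) r.+1 c F' -> slide F r c F'.

(* rectifies m F F': some sequence of slides into corners of the inner shape  *)
(* (with row lengths m) turns F into the straight-shape filling F'.           *)
Inductive rectifies : (nat -> nat) -> filling -> filling -> Prop :=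
| rectifies_done m F : (forall r, m r = 0) -> rectifies m F F
| rectifies_step m F F1 F' r :
    m r.+1 < m r -> slide F r (m r).-1 F1 ->
    rectifies (fun s => if s == r then (m r).-1 else m s) F1 F' ->
    rectifies m F F'.

(* V = J(F): V is the result of rectifying F, for whatever choice of corners. *)
Definition is_rectification n (nu : n.-tuple nat)
    (m : nat -> nat) (F : filling) (V : tab nu) : Prop :=
  (exists2 F', rectifies m F F' & F' =2 tab_filling V) /\
  (forall F', rectifies m F F' -> F' =2 tab_filling V).

(* Main.v *)
Require Import Defs.
From mathcomp Require Import all_boot all_order all_algebra.
From mathcomp Require Import zify.

(* The crystal operators are transported to words, T (x) U becoming the        *)
(* concatenation of the column words of T and U. Knuth equivalent words have   *)
(* equal eps, phi and weight, and e_i, f_i send them to Knuth equivalent words *)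
(* or kill both; on row words of tableaux e_i preserves the shape. Descending  *)
(* along the e_i to highest weight words, where a tableau is determined by its *)
(* weight, two tableaux with Knuth equivalent row words are therefore equal.   *)
(* Since column words, row words, row insertion and jeu de taquin slides all   *)
(* respect Knuth classes, this identifies J(T * U) with the insertion tableau  *)
(* of the word of T (x) U, and makes all rectifications agree.                 *)
(*   J^k is the insertion tableau of a prefix of that word, so e_i fixes its   *)
(* shape and R(T, U) is constant on components. At a highest weight element    *)
(* R (x) b_mu, inserting the row k^(mu_k) into J^k bumps from each row r       *)
(* exactly the letters k + r, hence the letters < k + r of row r are those of  *)
(* R and R(R, b_mu) = R. Finally the component of b is identified with B_nu by *)
(* sending x to the insertion tableau of its word.                             *)

(** Three facts about Knuth equivalence carry the proof. First, the crystal structure cannot tell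
    Knuth equivalent words apart ([knuth_same_crystal]): operators on a concatenation see a factor
    only through its [weps] and [wphi], so only the two three-letter relations have to be checked.
    Second, a Knuth class contains the row word of at most one tableau with a given number of rows
    ([knuth_tableau_inj]); the proof descends along the e_i, and [tableau_we] keeps the descent
    among tableaux. Third, row insertion ([knuth_insert_word]), reading by columns ([knuth_colword])
    and slides ([slide_knuth]) stay inside a Knuth class.

    The functions h_i and k_i are differences of letter counts over final and initial runs of
    columns, and their maxima are eps and phi of the column word. Hence e_i and f_i on tableaux are
    those of column words ([tab_eE], [tab_fE]), and both B_lambda and the tensor product embed in
    words ([reading_tab], [reading_tensor]). The word of T (x) U is Knuth equivalent to the row word
    of T * U, so every rectification is the insertion tableau V of that word ([star_rectification]).

    For the array: e_i either acts as e_i on the prefix of the word that defines J^k or leaves it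
    alone, so J^k keeps its shape ([Jshape_e]) and the array is constant on components. A highest
    weight element has second factor b_mu ([tensor_highest]), and there the array is the pattern of
    the first factor ([Rarray_hw]). A pattern determines its tableau ([gt_inj]), so a component has
    just one highest weight element b. Therefore Knuth equivalent elements of the component coincide
    ([knuth_component_inj]), sending x to the insertion tableau of its word identifies the component
    with B_nu ([lift_component_iso]), and T (x) U corresponds to V ([bracketE]). *)

Set Implicit Arguments.
Unset Strict Implicit.
Unset Printing Implicit Defensive.

(** * Crystal operators on words *)

(* The word a :: w is the tensor product of the letter a with w. *)
Fixpoint wphi i (w : seq nat) : nat :=
  if w is a :: w' then (a == i) + (wphi i w' - (a == i.+1)) else 0.

Fixpoint weps i (w : seq nat) : nat :=
  if w is a :: w' then weps i w' + ((a == i.+1) - wphi i w') else 0.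

Fixpoint we i (w : seq nat) : option (seq nat) :=
  if w is a :: w' then
    if wphi i w' < (a == i.+1) then Some (i :: w') else omap (cons a) (we i w')
  else None.

Fixpoint wf i (w : seq nat) : option (seq nat) :=
  if w is a :: w' then
    if wphi i w' <= (a == i.+1) then
      if a == i then Some (i.+1 :: w') else None
    else omap (cons a) (wf i w')
  else None.

Lemma eq_succ_excl (a i : nat) : (a == i) + (a == i.+1) <= 1.
Proof. lia. Qed.

(** The tensor product rule is associative: truncated subtraction is the maximum with 0, and by
    [eq_succ_excl] a single letter never contributes to both [wphi] and [weps]. *)
Lemma wphi_cat i u v : wphi i (u ++ v) = wphi i u + (wphi i v - weps i u).
Proof.
by elim: u => [|a u IH] /=; [lia | rewrite IH; have := eq_succ_excl a i; lia].
Qed.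

Lemma weps_cat i u v : weps i (u ++ v) = weps i v + (weps i u - wphi i v).
Proof.
elim: u => [|a u IH] /=; first lia.
by rewrite IH wphi_cat; have := eq_succ_excl a i; lia.
Qed.

Lemma omap_omap (T1 T2 T3 : Type) (f : T2 -> T3) (g : T1 -> T2) x :
  omap f (omap g x) = omap (f \o g) x.
Proof. by case: x. Qed.

Lemma we_cat i u v :
  we i (u ++ v) =
  if wphi i v < weps i u then omap (cat^~ v) (we i u) else omap (cat u) (we i v).
Proof.
elim: u => [|a u IH] /=; first by case: (we i v).
rewrite wphi_cat IH; have := eq_succ_excl a i => ai.
by do !case: ltnP => ?; rewrite ?omap_omap //; lia.
Qed.

Lemma weps_wphi i w : wphi i w + count_mem i.+1 w = weps i w + count_mem i w.
Proof.
elim: w => //= a w; rewrite /in_mem /=; move: (count _ w) (count _ w) => p q IH.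
move: IH; case: (a == i); case: (a == i.+1) => /=; lia.
Qed.

Lemma we_None i w : (we i w == None) = (weps i w == 0).
Proof.
elim: w => //= a w IH; case: ltnP => h; first by apply/esym/negbTE; rewrite -lt0n; lia.
by rewrite (eqP (_ : _ - _ == 0)) // addn0 -IH; case: (we i w).
Qed.

Lemma wf_None i w : (wf i w == None) = (wphi i w == 0).
Proof.
elim: w => //= a w IH; have := eq_succ_excl a i => ai; case: leqP => h.
  by rewrite (eqP (_ : _ - _ == 0)) // addn0; case: (a == i).
transitivity false; last by apply/esym/negbTE; rewrite -lt0n; lia.
have: (wf i w == None) = false by rewrite IH; apply/negbTE; rewrite -lt0n; lia.
by case: (wf i w).
Qed.

Lemma wf_cat i u v :
  wf i (u ++ v) =
  if wphi i v <= weps i u then omap (cat^~ v) (wf i u) else omap (cat u) (wf i v).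
Proof.
elim: u => [|a u IH] /=.
  case: leqP => [h|_]; last by case: (wf i v).
  by apply/eqP; rewrite wf_None; lia.
rewrite wphi_cat IH; have := eq_succ_excl a i => ai.
do !case: leqP => ?; rewrite ?omap_omap //; try lia.
by case: eqP.
Qed.

Lemma we_SomeE i w w' : we i w = Some w' ->
  exists u v, w = u ++ i.+1 :: v /\ w' = u ++ i :: v.
Proof.
elim: w w' => //= a w IH w'; case: ltnP => [h [<-]|_].
  by exists [::], w; split=> //=; congr cons; lia.
case E: (we i w) => [u|] //= [<-]; have [x [y [-> ->]]] := IH _ E.
by exists (a :: x), y.
Qed.

Lemma we_step i w w' : we i w = Some w' ->
  [/\ weps i w = (weps i w').+1, wphi i w' = (wphi i w).+1 & wf i w' = Some w].
Proof.
elim: w w' => //= a w IH w'; case: ltnP => [h [<-]|h] /=.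
  have -> : a = i.+1 by lia.
  have w0 : wphi i w = 0 by lia.
  have n1 : (i == i.+1) = false by apply/negbTE; lia.
  have n2 : (i.+1 == i) = false by apply/negbTE; lia.
  by rewrite !eqxx n1 n2 w0; split=> //; lia.
case E: (we i w) => [u|] //= [<-] /=; have [h1 h2 h3] := IH _ E.
by rewrite h2 (_ : _ <= _ = false) ?h3 //=; [split=> //; lia | lia].
Qed.

Lemma wf_step i w w' : wf i w = Some w' -> we i w' = Some w.
Proof.
elim: w w' => //= a w IH w'; case: leqP => [h|h] /=.
  case: eqP => //= ai [<-] /=; rewrite eqxx (_ : wphi i w = 0) ?ai //; lia.
case E: (wf i w) => [u|] //= [<-] /=; have h3 := IH _ E.
have [_ h2 _] := we_step h3.
by rewrite h3 (_ : _ < _ = false) //; lia.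
Qed.

(** * Knuth equivalence *)

Inductive knuth : seq nat -> seq nat -> Prop :=
| knuth_refl w : knuth w w
| knuth_sym u v : knuth u v -> knuth v u
| knuth_trans v u w : knuth u v -> knuth v w -> knuth u w
| knuth_xzy u v x y z : x <= y < z ->
    knuth (u ++ [:: x; z; y] ++ v) (u ++ [:: z; x; y] ++ v)
| knuth_yxz u v x y z : x < y <= z ->
    knuth (u ++ [:: y; x; z] ++ v) (u ++ [:: y; z; x] ++ v).

Lemma knuth_catl w u v : knuth u v -> knuth (w ++ u) (w ++ v).
Proof.
elim=> [u'|u' v' _ IH|u' v' w' _ IH1 _ IH2|u' v' x y z h|u' v' x y z h].
- exact: knuth_refl.
- exact: knuth_sym.
- exact: knuth_trans IH1 IH2.
- by rewrite !(catA w); apply: knuth_xzy.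
- by rewrite !(catA w); apply: knuth_yxz.
Qed.

Lemma knuth_catr w u v : knuth u v -> knuth (u ++ w) (v ++ w).
Proof.
elim=> [u'|u' v' _ IH|u' v' w' _ IH1 _ IH2|u' v' x y z h|u' v' x y z h].
- exact: knuth_refl.
- exact: knuth_sym.
- exact: knuth_trans IH1 IH2.
- by rewrite -!catA; apply: knuth_xzy.
- by rewrite -!catA; apply: knuth_yxz.
Qed.

Lemma knuth_cat u u' v v' : knuth u u' -> knuth v v' -> knuth (u ++ v) (u' ++ v').
Proof.
by move=> h1 h2; apply: (knuth_trans (knuth_catr _ h1)); apply: knuth_catl.
Qed.

Definition oknuth (x y : option (seq nat)) : Prop :=
  match x, y with
  | Some u, Some v => knuth u v
  | None, None => True
  | _, _ => False
  end.

Record same_crystal (u v : seq nat) : Prop := SameCrystal {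
  sc_perm : perm_eq u v;
  sc_eps : forall i, weps i u = weps i v;
  sc_phi : forall i, wphi i u = wphi i v;
  sc_e : forall i, oknuth (we i u) (we i v);
  sc_f : forall i, oknuth (wf i u) (wf i v) }.

Lemma oknuth_sym x y : oknuth x y -> oknuth y x.
Proof. by case: x y => [x|] [y|] //=; apply: knuth_sym. Qed.

Lemma oknuth_trans y x z : oknuth x y -> oknuth y z -> oknuth x z.
Proof. by case: x y z => [x|] [y|] [z|] //=; apply: knuth_trans. Qed.

(** Which factor an operator changes depends on the middle one only through [weps] and [wphi], which
    agree for [a] and [b]. If the change falls in [u] or [v], the results are equivalent because [a]
    and [b] are. *)
Lemma same_crystal_context u v a b : same_crystal a b -> knuth a b ->
  same_crystal (u ++ a ++ v) (u ++ b ++ v).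
Proof.
move=> [pab eab fab Eab Fab] kab; split=> [|i|i|i|i].
- by rewrite perm_cat2l perm_cat2r.
- by rewrite !(weps_cat, wphi_cat) eab fab.
- by rewrite !(weps_cat, wphi_cat) eab fab.
- rewrite !(we_cat, weps_cat, wphi_cat) eab fab.
  have := Eab i; do !case: ifP => _.
  + by case: (we i u) => //= w _; do !(apply: knuth_cat => //); apply: knuth_refl.
  + case: (we i a) (we i b) => [x|] [y|] //= h.
    by do !(apply: knuth_cat => //); apply: knuth_refl.
  + case: (we i v) => //= w _.
    by do !(apply: knuth_cat => //); apply: knuth_refl.
- rewrite !(wf_cat, weps_cat, wphi_cat) eab fab.
  have := Fab i; do !case: ifP => _.
  + by case: (wf i u) => //= w _; do !(apply: knuth_cat => //); apply: knuth_refl.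
  + case: (wf i a) (wf i b) => [x|] [y|] //= h.
    by do !(apply: knuth_cat => //); apply: knuth_refl.
  + case: (wf i v) => //= w _.
    by do !(apply: knuth_cat => //); apply: knuth_refl.
Qed.

Lemma knuth3_xzy x y z : x <= y < z -> knuth [:: x; z; y] [:: z; x; y].
Proof. exact: (@knuth_xzy [::] [::]). Qed.

Lemma knuth3_yxz x y z : x < y <= z -> knuth [:: y; x; z] [:: y; z; x].
Proof. exact: (@knuth_yxz [::] [::]). Qed.

Variant letter_spec (i a : nat) : bool -> bool -> Type :=
| LetterLo of a = i : letter_spec i a true false
| LetterHi of a = i.+1 : letter_spec i a false true
| LetterOther of a <> i & a <> i.+1 : letter_spec i a false false.

Lemma letterP i a : letter_spec i a (a == i) (a == i.+1).
Proof.
have [->|/eqP ai] := eqVneq a i; first by rewrite ltn_eqF //; constructor.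
by have [->|/eqP ai'] := eqVneq a i.+1; constructor.
Qed.

Ltac letters3 x y z i :=
  rewrite /=; case: (letterP i x) => *; case: (letterP i y) => *;
  case: (letterP i z) => *; rewrite //=.

Ltac knuth3_cases x y z i :=
  letters3 x y z i; try (exfalso; lia); subst;
  first [ exact: knuth_refl
        | apply: knuth3_xzy; lia
        | apply: knuth3_yxz; lia
        | apply: knuth_sym; apply: knuth3_xzy; lia
        | apply: knuth_sym; apply: knuth3_yxz; lia ].

Lemma same_crystal_xzy x y z : x <= y < z ->
  same_crystal [:: x; z; y] [:: z; x; y].
Proof.
move=> h; split=> [|i|i|i|i].
- by rewrite (perm_catCA [:: x] [:: z] [:: y]).
- by letters3 x y z i; lia.
- by letters3 x y z i; lia.
- by knuth3_cases x y z i.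
- by knuth3_cases x y z i.
Qed.

Lemma same_crystal_yxz x y z : x < y <= z ->
  same_crystal [:: y; x; z] [:: y; z; x].
Proof.
move=> h; split=> [|i|i|i|i].
- by rewrite (perm_cat2l [:: y]) (perm_catC [:: x]).
- by letters3 x y z i; lia.
- by letters3 x y z i; lia.
- by knuth3_cases x y z i.
- by knuth3_cases x y z i.
Qed.

Lemma knuth_same_crystal u v : knuth u v -> same_crystal u v.
Proof.
elim=> {u v} [w|u v _ [p e f E F]|v u w _ [p1 e1 f1 E1 F1] _ [p2 e2 f2 E2 F2]
             |u v x y z h|u v x y z h].
- split=> // i; first by case: (we i w) => //= x; apply: knuth_refl.
  by case: (wf i w) => //= x; apply: knuth_refl.
- split=> // [|i|i]; first by rewrite perm_sym.
    exact/oknuth_sym/E.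
  exact/oknuth_sym/F.
- split=> [|i|i|i|i]; first exact: perm_trans p1 p2.
  + by rewrite e1.
  + by rewrite f1.
  + exact: oknuth_trans (E1 i) (E2 i).
  + exact: oknuth_trans (F1 i) (F2 i).
- apply: same_crystal_context; last exact: knuth3_xzy.
  exact: same_crystal_xzy.
- apply: same_crystal_context; last exact: knuth3_yxz.
  exact: same_crystal_yxz.
Qed.

(** * Row insertion *)

Definition rw (t : seq (seq nat)) : seq nat := flatten (rev t).

Lemma rw_cons R t : rw (R :: t) = rw t ++ R.
Proof. by rewrite /rw rev_cons flatten_rcons. Qed.

Lemma rw_cat t1 t2 : rw (t1 ++ t2) = rw t2 ++ rw t1.
Proof. by rewrite /rw rev_cat flatten_cat. Qed.

Lemma perm_rw t : perm_eq (rw t) (flatten t).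
Proof. by apply: perm_flatten; rewrite perm_rev. Qed.

(** The letter [x] moves left through [S] by the second relation: the letter standing before the
    exchanged pair is always at least [y], hence greater than [x]. *)
Lemma knuth_pass_left y S x : sorted leq (y :: S) -> x < y ->
  knuth (y :: rcons S x) (y :: x :: S).
Proof.
elim/last_ind: S => [|S s IH] yS xy; first exact: knuth_refl.
have yS' : sorted leq (y :: S) by move: yS; rewrite /= rcons_path => /andP[].
have step : knuth (y :: rcons (rcons S s) x) (rcons (y :: rcons S x) s).
  have ps : last y S <= s by move: yS; rewrite /= rcons_path => /andP[].
  have yp : y <= last y S.
    have /allP h := order_path_min leq_trans yS'.
    by case: (S) h => //= z S' h; apply: h; exact: mem_last.
  have e Z : y :: S ++ Z = belast y S ++ last y S :: Z.
    by rewrite -cat_cons lastI cat_rcons.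
  rewrite -!cats1 -!catA /= -?catA !e; apply: knuth_sym.
  apply: (@knuth_yxz (belast y S) [::] x (last y S) s); lia.
apply: (knuth_trans step); rewrite -!cats1 -cat_cons.
by have := knuth_catr [:: s] (IH yS' xy); rewrite -!cats1 /= -!catA.
Qed.

(** The letter [y] moves left through [P] by the first relation; the letter on its right, always at
    most [x], is the middle value of the relation. *)
Lemma knuth_pass_right y P x : sorted leq (rcons P x) -> x < y ->
  knuth (P ++ [:: y; x]) (y :: rcons P x).
Proof.
elim/last_ind: P x => [|P p IH] x Px xy; first exact: knuth_refl.
have px : p <= x.
  by move: Px; rewrite -!cats1 -catA /= sorted_cat_cons //= => /andP[_] /andP[].
have Pp : sorted leq (rcons P p).
  by move: Px; rewrite -(cats1 (rcons P p)) => /cat_sorted2[].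
have step : knuth (rcons P p ++ [:: y; x]) (P ++ [:: y; p; x]).
  rewrite -cats1 -catA.
  by apply: (@knuth_xzy P [::]); lia.
apply: (knuth_trans step).
have := knuth_catr [:: x] (IH p Pp (leq_ltn_trans px xy)).
by rewrite -catA /= cats1.
Qed.

(** One step of row insertion: [x] takes the place of [y], and [y] moves in front of the row, that
    is, to the end of the row below. *)
Lemma knuth_bump P y S x :
  sorted leq (P ++ y :: S) -> sorted leq (rcons P x) -> x < y ->
  knuth (P ++ y :: rcons S x) (y :: P ++ x :: S).
Proof.
move=> PyS Px xy; have [_ yS] := cat_sorted2 PyS.
apply: (knuth_trans (knuth_catl P (knuth_pass_left yS xy))).
have := knuth_catr S (knuth_pass_right Px xy).
by rewrite -catA /= cat_rcons.
Qed.

Definition above (R S : seq nat) : bool :=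
  (size S <= size R) && all (fun j => nth 0 R j < nth 0 S j) (iota 0 (size S)).

Definition tableau (t : seq (seq nat)) : bool :=
  all (sorted leq) t && sorted above t.

Lemma aboveP R S :
  reflect (size S <= size R /\ forall j, j < size S -> nth 0 R j < nth 0 S j)
          (above R S).
Proof.
apply: (iffP andP) => -[h1 h2]; split=> //.
  by move=> j hj; apply: (allP h2); rewrite mem_iota.
by apply/allP => j; rewrite mem_iota => /andP[_ hj]; apply: h2.
Qed.

Lemma tableau_cons R t :
  tableau (R :: t) = [&& sorted leq R, above R (head [::] t) & tableau t].
Proof.
rewrite /tableau /=; case: t => [|S t] /=; first by rewrite !andbT.
by case: (sorted leq R); case: (above R S); rewrite ?andbF ?andbT //= andbF.
Qed.

Lemma head_row_insert t a :
  head [::] (row_insert t a) =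
  set_nth 0 (head [::] t) (find (ltn a) (head [::] t)) a.
Proof.
case: t => [|R t] //=; case: ltnP => //= h.
have -> : find (fun x => a < x) R = size R by apply/eqP; rewrite eqn_leq h find_size.
elim: R {h} => //= x R IH; by rewrite IH.
Qed.

Variant row_insert_spec (R : seq nat) (t : seq (seq nat)) (a : nat) :
  seq (seq nat) -> Type :=
| RowAppend of all (geq a) R : row_insert_spec R t a (rcons R a :: t)
| RowBump P y S of R = P ++ y :: S & all (geq a) P & a < y :
    row_insert_spec R t a ((P ++ a :: S) :: row_insert t y).

Lemma row_insertP R t a : row_insert_spec R t a (row_insert (R :: t) a).
Proof.
rewrite /=; case: ifP => h.
  have hP : all (geq a) (take (find (ltn a) R) R).
    apply/(all_nthP 0) => k; rewrite size_take h => hk; rewrite nth_take //=.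
    by rewrite leqNgt; apply/negbT; apply: (before_find 0 hk).
  rewrite set_nthE h /=.
  apply: RowBump => //; last by apply: (nth_find 0); rewrite has_find.
  by rewrite -drop_nth // cat_take_drop.
apply: RowAppend; apply/allP => x xR /=; rewrite leqNgt; apply/negP => ax.
by move/negbT/negP: h; apply; rewrite -has_find; apply/hasP; exists x.
Qed.

Lemma sorted_rcons_leq R a : sorted leq (rcons R a) = sorted leq R && all (geq a) R.
Proof.
rewrite !(sorted_pairwise leq_trans) -cats1 pairwise_cat /= andbT andbC.
by rewrite allrel1r.
Qed.

Lemma sorted_cat_leq R S :
  sorted leq (R ++ S) =
  [&& allrel leq R S, sorted leq R & sorted leq S].
Proof. by rewrite !(sorted_pairwise leq_trans) pairwise_cat. Qed.

Lemma sorted_cons_leq a S : sorted leq (a :: S) = all (leq a) S && sorted leq S.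
Proof. exact: (path_sortedE leq_trans). Qed.

Lemma allrel_leq_trans P y S : all (geq y) P -> all (leq y) S -> allrel leq P S.
Proof.
move=> /allP hP /allP hS; apply/allrelP => p s /hP /= py /hS ys.
exact: leq_trans py ys.
Qed.

Lemma sorted_replace P a y S : sorted leq (P ++ y :: S) -> all (geq a) P -> a <= y ->
  sorted leq (P ++ a :: S).
Proof.
rewrite !sorted_cat_leq !sorted_cons_leq => /and3P[hPS -> /andP[yS ->]] Pa ay.
have aS : all (leq a) S by apply: sub_all yS => z; exact: leq_trans.
rewrite aS !andbT (@allrel_leq_trans P a (a :: S)) //=.
by rewrite leqnn.
Qed.

Lemma knuth_row_insert t a : all (sorted leq) t ->
  knuth (rw (row_insert t a)) (rw t ++ [:: a]).
Proof.
elim: t a => [|R t IH] a; first by move=> _; exact: knuth_refl.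
move=> /andP[sR st]; case: row_insertP => [_|P y S eR Pa ay].
  by rewrite !rw_cons -cats1 catA; apply: knuth_refl.
rewrite !rw_cons eR.
apply: knuth_trans (knuth_catr _ (IH y st)) _; rewrite -!catA; apply: knuth_catl.
apply: knuth_sym; rewrite /= cats1; apply: knuth_bump => //.
  by rewrite -eR.
rewrite sorted_rcons_leq Pa andbT.
by move: sR; rewrite eR sorted_cat_leq => /and3P[].
Qed.

(** The bumped letter [y] settles weakly left of the column it leaves, because an entry of [S] in
    that column exceeds [y]. The entry above its new place is therefore at most [a], and [a < y]. *)
Lemma above_row_insert R S a y :
  above R S -> find (ltn a) R < size R -> nth 0 R (find (ltn a) R) = y ->
  above (set_nth 0 R (find (ltn a) R) a) (set_nth 0 S (find (ltn y) S) y).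
Proof.
move=> /aboveP[sRS RS]; set p := find _ R => pR py.
have ay : a < y by rewrite -py; apply: (nth_find 0 (a := ltn a)); rewrite has_find.
have qS : find (ltn y) S <= size S := find_size _ _.
have qp : find (ltn y) S <= p.
  have [pS|Sp] := ltnP p (size S); last exact: leq_trans Sp.
  rewrite leqNgt; apply/negP => h.
  by have := RS p pS; rewrite py (before_find 0 h : (y < _) = false).
move: qS qp; set q := find _ S => qS qp.
apply/aboveP; rewrite !size_set_nth; split; first lia.
move=> j hj; rewrite !nth_set_nth /=; have [jq|jq] := eqVneq j q.
  have [//|jp] := eqVneq j p.
  apply: leq_ltn_trans ay; have jp' : j < p by lia.
  by have := before_find 0 jp'; rewrite /= => /negbT; rewrite -leqNgt.
have jS : j < size S by lia.
have := RS j jS; have [->|//] := eqVneq j p.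
by rewrite py => yS; exact: ltn_trans ay yS.
Qed.

Lemma tableau_row_insert t a : tableau t -> tableau (row_insert t a).
Proof.
elim: t a => [//|R t IH] a; rewrite tableau_cons => /and3P[sR Rt tt].
have hd := head_row_insert (R :: t) a.
case: (row_insertP R t a) hd => [Ra|P y S eR Pa ay] hd.
  rewrite tableau_cons tt andbT sorted_rcons_leq sR Ra /=.
  case/aboveP: Rt => h1 h2; apply/aboveP; rewrite size_rcons; split; first lia.
  by move=> j hj; rewrite nth_rcons (leq_trans hj h1) h2.
rewrite tableau_cons IH // andbT (sorted_replace (y := y)) -?eR ?(ltnW ay) //=.
have fR : find (ltn a) R = size P.
  rewrite eR find_cat ifN /= ?ay ?addn0 //.
  by apply/hasPn => z zP /=; rewrite -leqNgt; apply: (allP Pa).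
rewrite head_row_insert; move: hd => /= ->; apply: above_row_insert => //.
  by rewrite fR eR size_cat /=; lia.
by rewrite fR eR nth_cat ltnn subnn.
Qed.

(** The letter that enters row [r] is at least [s + r] and bumps a strictly larger one, so a letter
    leaving the last row would be at least [s + size t], outside the alphabet. *)
Lemma size_row_insert s t a : tableau t -> all (leq s) (head [::] t) -> s <= a ->
  all (gtn (s + size t)) (a :: flatten t) -> size (row_insert t a) = size t.
Proof.
elim: t s a => [|R t IH] s a; first by move=> _ _ sa /=; lia.
rewrite tableau_cons -(cat1s a) -[flatten (R :: t)]/(R ++ flatten t) !all_cat.
move=> /and3P[sR Rt tt] sR' sa /and3P[an Rn tn].
case: (row_insertP R t a) => [//|P y S eR Pa ay] /=.
congr _.+1; apply: (IH s.+1) => //=.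
- case/aboveP: Rt => h1 h2; apply/(all_nthP 0) => j hj.
  apply: leq_ltn_trans (h2 j hj); apply: (all_nthP 0 sR'); exact: leq_trans h1.
- exact: leq_ltn_trans ay.
- rewrite addSnnS tn andbT; apply: (allP Rn); rewrite eR mem_cat inE eqxx.
  by rewrite orbT.
Qed.

(** Empty rows are kept, so that tableaux in the letters below [n] all have exactly [n] rows and can
    be compared by [knuth_tableau_inj]. *)
Definition ntableau n (t : seq (seq nat)) : bool :=
  [&& tableau t, size t == n & all (gtn n) (flatten t)].

Lemma perm_row_insert t a : tableau t ->
  perm_eq (flatten (row_insert t a)) (a :: flatten t).
Proof.
move=> /andP[tt _]; apply: perm_trans (_ : perm_eq _ (rw (row_insert t a))) _.
  by rewrite perm_sym perm_rw.
apply: perm_trans (sc_perm (knuth_same_crystal (knuth_row_insert a tt))) _.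
by rewrite cats1 perm_rcons perm_cons perm_rw.
Qed.

Lemma ntableau_row_insert n t a : ntableau n t -> a < n ->
  ntableau n (row_insert t a).
Proof.
move=> /and3P[tt /eqP st an'] an; apply/and3P; split.
- exact: tableau_row_insert.
- rewrite (@size_row_insert 0) ?st //=; first by apply/allP.
  by rewrite an.
- by rewrite (perm_all _ (perm_row_insert a tt)) /= an.
Qed.

Lemma ntableau_insert_word n t w : ntableau n t -> all (gtn n) w ->
  ntableau n (foldl row_insert t w).
Proof.
elim: w t => //= a w IH t tt /andP[an wn].
by apply: IH => //; apply: ntableau_row_insert.
Qed.

Lemma knuth_insert_word t w : tableau t ->
  knuth (rw (foldl row_insert t w)) (rw t ++ w).
Proof.
elim: w t => [|a w IH] t tt /=; first by rewrite cats0; exact: knuth_refl.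
apply: knuth_trans (IH _ (tableau_row_insert a tt)) _.
rewrite -cat1s catA; apply: knuth_catr; apply: knuth_row_insert.
by case/andP: tt.
Qed.

Lemma ntableau_nil n : ntableau n (nseq n [::]).
Proof.
apply/and3P; split; last 1 first.
- by have -> : flatten (nseq n ([::] : seq nat)) = [::] by elim: n.
- by elim: n => // n IH; rewrite -[nseq _ _]/([::] :: nseq n [::]) tableau_cons IH; case: n {IH}.
- by rewrite size_nseq.
Qed.

Lemma rw_nil n : rw (nseq n [::]) = [::].
Proof. by apply/nilP; rewrite /nilp (perm_size (perm_rw _)); elim: n. Qed.

(** * Crystal operators on row words of tableaux *)

Lemma all_ltn_index s t : tableau t -> all (leq s) (head [::] t) ->
  forall r x, x \in nth [::] t r -> s + r <= x.
Proof.
elim: t s => [|R t IH] s; first by move=> _ _ [].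
rewrite tableau_cons => /and3P[sR Rt tt] /= sR' [|r] x /=.
  by rewrite addn0; apply: (allP sR').
move=> h; rewrite -addSnnS; apply: IH h => //.
case/aboveP: Rt => h1 h2; apply/(all_nthP 0) => j hj.
apply: leq_ltn_trans (h2 j hj); apply: (all_nthP 0 sR'); exact: leq_trans h1.
Qed.

(** A letter [i.+1] cancels only against an [i] to its right, and a weakly increasing word offers
    none. *)
Lemma sorted_wphi_weps i R : sorted leq R ->
  wphi i R = count_mem i R /\ weps i R = count_mem i.+1 R.
Proof.
elim: R => //= a R IH /[dup] aR /path_sorted/IH [-> ->].
have : a <> i.+1 \/ count_mem i R = 0.
  have [ai|] := eqVneq a i.+1; [right|by move/eqP; left].
  apply/count_memPn; apply/negP => iR.
  have := allP (order_path_min leq_trans aR) _ iR; lia.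
case: (letterP i a) => [ai|ai|ai ai1] [h|h]; rewrite ?h ?subn0 /=; lia.
Qed.

Lemma we_sorted i R R' : sorted leq R -> we i R = Some R' ->
  exists u v, [/\ R = u ++ i.+1 :: v, R' = u ++ i :: v & all (geq i) u].
Proof.
elim: R R' => //= a R IH R' aR; case: ltnP => [h [<-]|h].
  by exists [::], R; split=> //=; congr cons; lia.
case E: (we i R) => [w|] //= [<-].
have [u [v [eR -> ui]]] := IH _ (path_sorted aR) E.
exists (a :: u), v; split=> //=; rewrite ?eR // ui andbT.
have : a <= i.+1.
  by apply: (allP (order_path_min leq_trans aR)); rewrite eR mem_cat inE eqxx orbT.
rewrite leq_eqVlt => /orP[/eqP ai|//]; move: h.
have [-> _] := sorted_wphi_weps i (path_sorted aR).
rewrite ai eqxx lt0n => /eqP; case; apply/count_memPn; apply/negP => iR.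
by have := allP (order_path_min leq_trans aR) _ iR; lia.
Qed.

Lemma count_mem_nth (a : nat) s :
  count_mem a s = count (fun k => nth 0 s k == a) (iota 0 (size s)).
Proof. by rewrite -[in LHS](mkseq_nth 0 s) count_map. Qed.

Lemma leq_count_in (T : eqType) (A B : pred T) s :
  (forall x, x \in s -> A x -> B x) -> count A s <= count B s.
Proof.
elim: s => //= x s IH h; apply: leq_add; last first.
  by apply: IH => y ys; apply: h; rewrite inE ys orbT.
by have := h x (mem_head _ _); case: (A x) => // ->.
Qed.

(* e_i lowers the first letter i+1 of R. If the entry of Q above it were i,    *)
(* then Q would have an i above every i+1 of R.                               *)
Lemma above_we i Q R R' : sorted leq Q -> sorted leq R -> above Q R ->
  we i R = Some R' -> count_mem i Q < count_mem i.+1 R -> above Q R'.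
Proof.
move=> sQ sR /aboveP[szQ QR] eR; have [u [v [dR -> ui]]] := we_sorted sR eR.
move=> cnt; apply/aboveP; have szR : size (u ++ i :: v) = size R.
  by rewrite dR !size_cat.
rewrite szR; split=> // j hj; have := QR j hj; rewrite dR !nth_cat.
case: (ltnP j (size u)) => // uj; case E: (j - size u) => [|k] //=.
have ju : j = size u by lia.
rewrite ltnS leq_eqVlt => /orP[/eqP Qj|//]; move: cnt; rewrite ltnNge => /negP[].
rewrite [X in X <= _]count_mem_nth count_mem_nth.
apply: leq_trans (_ : count (fun k => nth 0 Q k == i) (iota 0 (size R)) <= _).
  apply: leq_count_in => k; rewrite mem_iota /= => kR /eqP Rk.
  have := QR k kR; rewrite Rk ltnS => Qk; rewrite eqn_leq Qk /= -Qj.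
  apply: (sorted_leq_nth leq_trans leqnn) => //; rewrite ?inE; try lia.
  rewrite leqNgt; apply/negP => kj; move: Rk; rewrite dR nth_cat -ju kj => Rk.
  by have := allP ui _ (mem_nth 0 (_ : k < size u)); rewrite Rk /= => /(_ _); lia.
rewrite -(subnKC szQ) iotaD count_cat; exact: leq_addr.
Qed.

Lemma above_we_l i R R' S : sorted leq R -> above R S -> we i R = Some R' ->
  above R' S.
Proof.
move=> sR /aboveP[h1 h2] /(we_sorted sR)[u [v [dR -> _]]]; apply/aboveP.
move: h1 h2; rewrite dR !size_cat => h1 h2; split=> // j /h2.
by rewrite !nth_cat; case: (ltnP j (size u)) => // _; case: (j - size u) => //= /ltnW.
Qed.

Lemma sorted_we i R R' : sorted leq R -> we i R = Some R' -> sorted leq R'.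
Proof.
move=> sR /(we_sorted sR)[u [v [dR -> ui]]]; apply: (sorted_replace (y := i.+1)) => //.
by rewrite -dR.
Qed.

Lemma size_we i w w' : we i w = Some w' -> size w' = size w.
Proof. by move/we_SomeE => [u [v [-> ->]]]; rewrite !size_cat. Qed.

(** The last clause serves the induction. When e_i changes the top row of the lower part [t], the
    letters [i.+1] of that row number [weps i (rw t)], which exceeds the number of [i] in the row
    [R] above; this is the hypothesis of [above_we]. *)
Lemma tableau_we t i w : tableau t -> we i (rw t) = Some w ->
  exists t', [/\ w = rw t', tableau t', map size t' = map size t &
    head [::] t' = head [::] t \/
    we i (head [::] t) = Some (head [::] t') /\ weps i (rw t) = weps i (head [::] t)].
Proof.
elim: t w => [|R t IH] w //; rewrite tableau_cons => /and3P[sR Rt tt].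
rewrite rw_cons we_cat; case: ltnP => h.
  case E: (we i (rw t)) => [w1|] //= [<-].
  have [t' [-> tt' st' ht']] := IH _ tt E.
  exists (R :: t'); split=> //=; [by rewrite rw_cons| |by rewrite st'|by left].
  rewrite tableau_cons sR tt' andbT /=.
  case: ht' => [-> //|[e1 e2]].
  have shd : sorted leq (head [::] t) by case: (t) tt => // ? ?; rewrite tableau_cons => /andP[].
  apply: above_we e1 _ => //.
  have [_ <-] := sorted_wphi_weps i shd.
  by have [<- _] := sorted_wphi_weps i sR; rewrite -e2.
case E: (we i R) => [R'|] //= [<-].
exists (R' :: t); split=> /=.
- by rewrite rw_cons.
- by rewrite tableau_cons tt andbT (sorted_we sR E) (above_we_l sR Rt E).
- by rewrite (size_we E).
- by right; split=> //; rewrite weps_cat; lia.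
Qed.

(** The first row ends the word, so its own [weps] vanishes too and, being sorted, it has no letter
    above [s]. For [i > s] it then offers no [i] to cancel against, so the remaining rows satisfy
    the same hypothesis from [s.+1] on. *)
Lemma hw_rows s t : tableau t -> all (leq s) (head [::] t) ->
  (forall i, s <= i -> weps i (rw t) = 0) ->
  forall r, nth [::] t r = nseq (size (nth [::] t r)) (s + r).
Proof.
elim: t s => [|R t IH] s; first by move=> _ _ _ r; rewrite nth_nil.
rewrite tableau_cons => /and3P[sR Rt tt] /= sR' h.
have eR : R = nseq (size R) s.
  apply/all_pred1P; apply/allP => x xR /=; have := allP sR' _ xR.
  rewrite leq_eqVlt eq_sym => /orP[//|sx].
  have /(_ x.-1) := h; rewrite rw_cons weps_cat => h'.
  have: weps x.-1 R = 0 by have := h' ltac:(lia); lia.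
  have [_ ->] := sorted_wphi_weps x.-1 sR; rewrite prednK; last lia.
  by move=> /count_memPn; rewrite xR.
move=> [|r] /=; first by rewrite addn0.
rewrite -addSnnS; apply: IH => //.
  case/aboveP: Rt => h1 h2; apply/(all_nthP 0) => j hj.
  apply: leq_ltn_trans (h2 j hj); apply: (all_nthP 0 sR'); exact: leq_trans h1.
move=> i si; have := h i (ltnW si); rewrite rw_cons weps_cat.
have [-> _] := sorted_wphi_weps i sR.
rewrite (count_memPn _) ?subn0; first lia.
by apply/negP; rewrite eR mem_nseq => /andP[_ /eqP]; lia.
Qed.

Lemma hw_count t : (forall r, nth [::] t r = nseq (size (nth [::] t r)) r) ->
  forall r, size (nth [::] t r) = count_mem r (rw t).
Proof.
move=> h r; rewrite (permP (perm_rw t)).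
have : forall s, (forall k, nth [::] t k = nseq (size (nth [::] t k)) (s + k)) ->
    size (nth [::] t r) = count_mem (s + r) (flatten t).
  elim: t {h} r => [|R t IH] r s h; first by rewrite nth_nil.
  have := h 0; rewrite /= addn0 => eR; rewrite count_cat.
  have ht k : nth [::] t k = nseq (size (nth [::] t k)) (s.+1 + k).
    by have := h k.+1; rewrite /= -addSnnS.
  case: r => [|r] /=.
    rewrite addn0 {1 2}eR size_nseq count_nseq /= eqxx mul1n.
    rewrite (count_memPn _) ?addn0 //; apply/negP => /flattenP[S St sS].
    have := ht (index S t); rewrite nth_index // => eS.
    by move: sS; rewrite eS mem_nseq => /andP[_ /eqP]; lia.
  rewrite -addSnnS -IH // eR count_nseq /= [_ == _]ltn_eqF ?add0n //; lia.
by move/(_ 0); apply.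
Qed.

Lemma we_dec w : (exists i w', we i w = Some w') \/ (forall i, we i w = None).
Proof.
have [/hasP[a _]|h] := boolP (has (fun a => we a.-1 w != None) w).
  by case E: (we a.-1 w) => [w'|] // _; left; exists a.-1, w'.
right=> i; case E: (we i w) => [w'|] //; case/hasP: h; exists i.+1; last by rewrite /= E.
by have [u [v [-> _]]] := we_SomeE E; rewrite mem_cat inE eqxx orbT.
Qed.

(** The sum of the letters is the measure for all descents along the e_i. *)
Lemma sumn_we i w w' : we i w = Some w' -> sumn w = (sumn w').+1.
Proof. by move/we_SomeE => [u [v [-> ->]]]; rewrite !sumn_cat /=; lia. Qed.

Lemma rw_inj t t' : map size t = map size t' -> rw t = rw t' -> t = t'.
Proof.
move=> h e; apply: (can_inj revK); apply: eq_from_flatten_shape => //.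
by rewrite /shape !map_rev h.
Qed.

Lemma knuth_we i u v u' : knuth u v -> we i u = Some u' ->
  exists2 v', we i v = Some v' & knuth u' v'.
Proof.
move/knuth_same_crystal/sc_e => /(_ i); case: (we i u) => [x|] // h [<-].
by case: (we i v) h => [y|] //= h; exists y.
Qed.

Lemma knuth_wf i u v u' : knuth u v -> wf i u = Some u' ->
  exists2 v', wf i v = Some v' & knuth u' v'.
Proof.
move/knuth_same_crystal/sc_f => /(_ i); case: (wf i u) => [x|] // h [<-].
by case: (wf i v) h => [y|] //= h; exists y.
Qed.

(** If some e_i applies to one word it applies to both; the results are row words of tableaux that
    agree by induction, and f_i leads back to equal words. If no e_i applies, row [r] consists of
    letters [r], and its length is a multiplicity that the two words share. *)
Theorem knuth_tableau_inj t t' : tableau t -> tableau t' -> size t = size t' ->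
  knuth (rw t) (rw t') -> t = t'.
Proof.
have [m] := ubnP (sumn (rw t)); elim: m t t' => // m IH t t' ltm tt tt' szt k.
have [[i [w e]]|hw] := we_dec (rw t).
  have [w' e' k'] := knuth_we k e.
  have [t1 [ew tt1 s1 _]] := tableau_we tt e.
  have [t1' [ew' tt1' s1' _]] := tableau_we tt' e'; subst w w'.
  have sz1 : size t1 = size t by rewrite -(size_map size) s1 size_map.
  have sz1' : size t1' = size t' by rewrite -(size_map size) s1' size_map.
  have e1 : t1 = t1'.
    by apply: IH => //; [have := sumn_we e; lia | rewrite sz1 sz1'].
  apply: rw_inj; first by rewrite -s1 -s1' e1.
  have [_ _ f] := we_step e; have [_ _ f'] := we_step e'.
  by move: f'; rewrite -e1 f => -[].
have e0 i : weps i (rw t) = 0 by apply/eqP; rewrite -we_None hw.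
have e0' i : weps i (rw t') = 0 by rewrite -(sc_eps (knuth_same_crystal k)).
have h : forall r, nth [::] t r = nseq (size (nth [::] t r)) r.
  by apply: (@hw_rows 0) => //; apply/allP.
have h' : forall r, nth [::] t' r = nseq (size (nth [::] t' r)) r.
  by apply: (@hw_rows 0) => //; apply/allP.
apply: (@eq_from_nth _ [::]) => // r _; rewrite h h' !hw_count //.
by rewrite (permP (sc_perm (knuth_same_crystal k))).
Qed.

(** * Column words *)

Definition tcolumn (t : seq (seq nat)) (j : nat) : seq nat :=
  [seq nth 0 R j | R <- t & j < size R].

Definition colword (t : seq (seq nat)) (m : nat) : seq nat :=
  flatten [seq rev (tcolumn t j) | j <- iota 0 m].

Lemma row_insert_rcons R d t c : all (geq c) R -> c < d ->
  row_insert (rcons R d :: t) c = rcons R c :: row_insert t d.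
Proof.
move=> Rc cd; have hR : has (fun x => c < x) R = false.
  by apply/hasPn => x /(allP Rc) /=; rewrite -leqNgt.
rewrite /= -!cats1 find_cat hR /= cd addn0 size_cat addn1 leqnn.
rewrite nth_cat ltnn subnn /=; congr (_ :: _).
by elim: R {Rc hR} => //= x R ->.
Qed.

(** The column arrives largest letter first, and each further letter bumps its predecessor from the
    end of the first row. That row keeps [c], and the rows below receive the rest of the column in
    the same order. *)
Lemma insert_column R t c C : all (geq c) R -> sorted ltn (c :: C) ->
  foldl row_insert (R :: t) (rev (c :: C)) =
  rcons R c :: foldl row_insert t (rev C).
Proof.
elim: C c => [|d C IH] c Rc.
  move=> _; rewrite /= ; case: ifP => // h; exfalso.
  move: h; rewrite -has_find => /hasP[x /(allP Rc) /=]; lia.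
move=> /= /andP[cd dC]; rewrite [rev (c :: _)]rev_cons foldl_rcons IH //; last first.
  by apply: sub_all Rc => x /= h; apply: leq_trans h (ltnW cd).
by rewrite row_insert_rcons // rev_cons foldl_rcons.
Qed.

Lemma tcolumn_cons R t j :
  tcolumn (R :: t) j = if j < size R then nth 0 R j :: tcolumn t j else tcolumn t j.
Proof. by rewrite /tcolumn /=; case: ifP. Qed.

Lemma tcolumn_nil R t j : size R <= j -> above R (head [::] t) -> tableau t ->
  tcolumn t j = [::].
Proof.
elim: t R => // S t IH R Rj /aboveP[/= h1 _].
rewrite tableau_cons tcolumn_cons => /and3P[_ h3 h4]; rewrite ifN; last lia.
by apply: (IH S) => //; lia.
Qed.

Lemma tcolumn_sorted t j : tableau t -> sorted ltn (tcolumn t j).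
Proof.
elim: t => // R t IH; rewrite tableau_cons tcolumn_cons => /and3P[sR Rt tt].
case: ifP => jR; last exact: IH.
rewrite /= (path_sortedE ltn_trans) IH // andbT.
elim: t R Rt jR tt {IH sR} => // S t IH R /aboveP[/= h1 h2] jR.
rewrite tableau_cons tcolumn_cons => /and3P[sS St tt].
case: ifP => [jS|/negbT jS] /=.
  rewrite h2 //=; apply: sub_all (IH S St jS tt) => x.
  by apply: ltn_trans; exact: h2.
by rewrite (tcolumn_nil _ St) // leqNgt.
Qed.

Lemma insert_tcolumn t j : tableau t ->
  foldl row_insert (map (take j) t) (rev (tcolumn t j)) = map (take j.+1) t.
Proof.
elim: t => // R t IH tRt; have sc := tcolumn_sorted j tRt.
move: tRt sc; rewrite tableau_cons tcolumn_cons => /and3P[sR Rt tt].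
case: ifP => [jR|/negbT jR] sc /=.
  rewrite insert_column //; last first.
    apply/allP => x /(nthP 0)[k]; rewrite size_take jR => kj <-.
    rewrite nth_take //=; apply: (sorted_leq_nth leq_trans leqnn) => //.
      by rewrite inE; lia.
    exact: ltnW.
  by rewrite (IH tt) (take_nth 0).
have := IH tt; rewrite (tcolumn_nil _ Rt) //=; last lia.
by move=> ->; rewrite !take_oversize //; lia.
Qed.

Lemma insert_colword t m : tableau t ->
  foldl row_insert (nseq (size t) [::]) (colword t m) = map (take m) t.
Proof.
move=> tt; elim: m => [|m IH].
  rewrite /colword /=; elim: t {tt} => //= R t ->; by rewrite take0.
rewrite /colword -addn1 iotaD map_cat flatten_cat foldl_cat -/(colword t m) IH.
by rewrite /= cats0 insert_tcolumn // addn1.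
Qed.

Lemma insert_colword_id t m : tableau t -> all (fun R => size R <= m) t ->
  foldl row_insert (nseq (size t) [::]) (colword t m) = t.
Proof.
move=> tt tm; rewrite insert_colword //.
by elim: t tm {tt} => //= R t IH /andP[/take_oversize -> /IH ->].
Qed.

(** Inserting the column word rebuilds the tableau, and insertion preserves the Knuth class. *)
Lemma knuth_colword t m : tableau t -> all (fun R => size R <= m) t ->
  knuth (rw t) (colword t m).
Proof.
move=> tt tm; rewrite -{1}(insert_colword_id tt tm).
have /and3P[h _ _] := ntableau_nil (size t).
by have := knuth_insert_word (colword t m) h; rewrite rw_nil.
Qed.

(** * Words that are concatenations of columns *)

(** In a decreasing word [i.+1] stands before [i], so the two cancel when both occur. *)
Lemma column_sig i D : sorted gtn D ->
  weps i D = (i.+1 \in D) && (i \notin D) /\ wphi i D = (i \in D) && (i.+1 \notin D)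
  :> nat.
Proof.
elim: D => //= a D IH /[dup] aD /path_sorted/IH[-> ->].
have lt x : x \in D -> x < a.
  by apply: (allP (order_path_min (rev_trans ltn_trans) aD)).
rewrite !inE ![_ == a]eq_sym.
case: (letterP i a) => [ai|ai|ai ai1] /=.
- have -> : (i \in D) = false by apply/negP => /lt; lia.
  by have -> : (i.+1 \in D) = false by apply/negP => /lt; lia.
- have -> : (i.+1 \in D) = false by apply/negP => /lt; lia.
  by case: (i \in D).
- by case: (i \in D); case: (i.+1 \in D).
Qed.

Definition recolor_letter (a b x : nat) := if x == a then b else x.

Lemma recolor_notin a b u : a \notin u -> map (recolor_letter a b) u = u.
Proof.
move=> au; rewrite -[RHS]map_id; apply/eq_in_map => x xu.
by rewrite /recolor_letter; case: eqP => // xa; rewrite -xa xu in au.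
Qed.

Lemma column_we i D D' : sorted gtn D -> we i D = Some D' ->
  [/\ i.+1 \in D, i \notin D & D' = map (recolor_letter i.+1 i) D].
Proof.
move=> sD e; have [h1 _] := column_sig i sD; have [h2 _ _] := we_step e.
have uD : uniq D by apply: (sorted_uniq (rev_trans ltn_trans) _ sD) => x; exact: ltnn.
have [u [v [dD dD']]] := we_SomeE e.
have /andP[-> ->] : (i.+1 \in D) && (i \notin D) by move: h1; rewrite h2; case: (_ && _).
split=> //; move: uD; rewrite dD cat_uniq /= => /and3P[_ h3 /andP[h4 _]].
rewrite dD' map_cat /= {2}/recolor_letter eqxx !recolor_notin //.
by apply: contra h3 => ->.
Qed.

Lemma column_wf i D D' : sorted gtn D -> wf i D = Some D' ->
  [/\ i \in D, i.+1 \notin D & D' = map (recolor_letter i i.+1) D].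
Proof.
move=> sD f; have e := wf_step f.
have [_ h1] := column_sig i sD; have [_ h2 _] := we_step e.
have uD : uniq D by apply: (sorted_uniq (rev_trans ltn_trans) _ sD) => x; exact: ltnn.
have [u [v [dD' dD]]] := we_SomeE e.
have /andP[-> ->] : (i \in D) && (i.+1 \notin D) by move: h1; rewrite h2; case: (_ && _).
split=> //; move: uD; rewrite dD cat_uniq /= => /and3P[_ h3 /andP[h4 _]].
rewrite dD' map_cat /= {2}/recolor_letter eqxx !recolor_notin //.
by apply: contra h3 => ->.
Qed.

Section ColumnExcess.
Import Order.TTheory GRing.Theory Num.Theory.
Local Open Scope ring_scope.

(** On the word of the columns from [j] on this is h_i(j); on that of the columns up to [j] it is
    -k_i(j). *)
Definition excess i (w : seq nat) : int := (count_mem i.+1 w)%:Z - (count_mem i w)%:Z.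

Lemma excessE i w : excess i w = (weps i w)%:Z - (wphi i w)%:Z.
Proof. by have := weps_wphi i w; rewrite /excess; lia. Qed.

Lemma excess_cat i u v : excess i (u ++ v) = excess i u + excess i v.
Proof. by rewrite /excess !count_cat; lia. Qed.

Lemma excess_suffix i u v : excess i v <= (weps i (u ++ v))%:Z.
Proof. by rewrite excessE weps_cat; lia. Qed.

Lemma excess_prefix i u v : - excess i u <= (wphi i (u ++ v))%:Z.
Proof. by rewrite excessE wphi_cat; lia. Qed.

(** By [excess_suffix] no suffix exceeds [weps]. If e_i acts on the first column, that column adds 1
    to the [weps] of the others, so all later suffixes stay strictly below the maximum; otherwise it
    adds nothing and induction applies. So [D] is the last column where the maximum is attained, as
    in the definition of e_i on tableaux. *)
Lemma we_columns i cs w : all (sorted gtn) cs -> we i (flatten cs) = Some w ->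
  exists C1 D D' C2,
  [/\ cs = C1 ++ D :: C2, we i D = Some D', w = flatten (C1 ++ D' :: C2),
      excess i (flatten (D :: C2)) = (weps i (flatten cs))%:Z &
      forall j, (size C1 < j)%N ->
        excess i (flatten (drop j cs)) < (weps i (flatten cs))%:Z].
Proof.
elim: cs w => // D cs IH w /andP[sD scs] /=; rewrite we_cat weps_cat.
have [hD1 hD2] := column_sig i sD; case: (ltnP (wphi i _) (weps i D)) => h.
  case E: (we i D) => [D'|] //= [<-]; exists [::], D, D', cs; split=> //=.
    rewrite excess_cat !excessE; move: h hD1 hD2.
    by case: (i \in D) (i.+1 \in D) => [] [] /= *; lia.
  move=> [|j] // _; have := excess_suffix i (flatten (take j cs)) (flatten (drop j cs)).
  by rewrite -flatten_cat cat_take_drop /=; lia.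
case E: (we i (flatten cs)) => [w'|] //= [<-].
have [C1 [D1 [D' [C2 [ecs e1 -> e3 e4]]]]] := IH _ scs E.
exists (D :: C1), D1, D', C2; split=> //=; first by rewrite ecs.
  by move: e3; rewrite /=; lia.
by move=> [|j] // hj; have := e4 j hj; rewrite -[drop j.+1 (D :: cs)]/(drop j cs); lia.
Qed.

(** Mirror image of [we_columns]: the induction removes the last column, and [D] is the first column
    where the prefixes reach the maximum. *)
Lemma wf_columns i cs w : all (sorted gtn) cs -> wf i (flatten cs) = Some w ->
  exists C1 D D' C2,
  [/\ cs = C1 ++ D :: C2, wf i D = Some D', w = flatten (C1 ++ D' :: C2),
      - excess i (flatten (rcons C1 D)) = (wphi i (flatten cs))%:Z &
      forall j, (j < size C1)%N ->
        - excess i (flatten (take j.+1 cs)) < (wphi i (flatten cs))%:Z].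
Proof.
elim/last_ind: cs w => // cs D IH w.
rewrite all_rcons => /andP[sD scs]; rewrite flatten_rcons wf_cat wphi_cat.
have [hD1 hD2] := column_sig i sD; case: (leqP (wphi i D) (weps i _)) => h.
  case E: (wf i (flatten cs)) => [w'|] //= [<-].
  have [C1 [D1 [D' [C2 [ecs e1 -> e3 e4]]]]] := IH _ scs E.
  exists C1, D1, D', (rcons C2 D); split=> //.
  - by rewrite ecs rcons_cat.
  - by rewrite -rcons_cons -rcons_cat flatten_rcons.
  - by move: e3; rewrite -?ecs; lia.
  move=> j hj; have := e4 j hj; rewrite -cats1 takel_cat; first lia.
  by rewrite ecs size_cat; lia.
case E: (wf i D) => [D'|] //= [<-]; exists cs, D, D', [::]; split=> //.
- by rewrite cats1.
- by rewrite cats1 flatten_rcons.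
- rewrite flatten_rcons excess_cat !excessE; move: h hD1 hD2.
  by case: (i \in D) (i.+1 \in D) => [] [] /= *; lia.
move=> j hj; rewrite -cats1 takel_cat //.
have := excess_prefix i (flatten (take j.+1 cs)) (flatten (drop j.+1 cs)).
by rewrite -flatten_cat cat_take_drop; lia.
Qed.

End ColumnExcess.

(** * Tableaux as lists of rows *)

Lemma count_split (X : Type) (A B C : pred X) s :
  (forall x, C x = A x + B x :> nat) -> count C s = count A s + count B s.
Proof. by move=> h; elim: s => //= x s ->; rewrite h; lia. Qed.


Section TabRows.
Variables (n : nat) (lam : n.-tuple nat).
Hypothesis hlam : sorted geq lam.
Implicit Types (T : tab lam) (r : 'I_n).

Definition mkcell r (c : 'I_(tnth lam r)) : cell lam :=
  Tagged (fun r => 'I_(tnth lam r)) c.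

Lemma part_le (r s : 'I_n) : r <= s -> tnth lam s <= tnth lam r.
Proof.
move=> rs; rewrite !(tnth_nth 0).
have tr : transitive geq by move=> y x z h1 h2; apply: leq_trans h2 h1.
apply: (sorted_leq_nth tr leqnn 0 hlam) => //; by rewrite inE size_tuple.
Qed.

Lemma col_lt_width (x : cell lam) : col_of x < width lam.
Proof.
apply: leq_trans (ltn_ord (tagged x)) _; rewrite /width.
case: x => r c /=; have n0 : 0 < n by apply: leq_ltn_trans (ltn_ord r).
by have := part_le (leq0n r : Ordinal n0 <= r); rewrite [X in _ <= X](tnth_nth 0).
Qed.

Lemma tab_row T (x y : cell lam) :
  row_of x = row_of y -> col_of x <= col_of y -> val T x <= val T y.
Proof.
move=> xy cxy; have /forallP/(_ x)/forallP/(_ y)/andP[h _] := valP T.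
by apply: (implyP h); rewrite xy eqxx.
Qed.

Lemma tab_col T (x y : cell lam) :
  row_of x < row_of y -> col_of x = col_of y -> val T x < val T y.
Proof.
move=> xy cxy; have /forallP/(_ x)/forallP/(_ y)/andP[_ h] := valP T.
by apply: (implyP h); rewrite cxy eqxx xy.
Qed.

Definition trow T r : seq nat :=
  [seq nat_of_ord (val T (mkcell c)) | c <- enum 'I_(tnth lam r)].

Lemma size_rows T : size (rows T) = n.
Proof. by rewrite size_map size_enum_ord. Qed.

Lemma nth_rows T r : nth [::] (rows T) r = trow T r.
Proof. by rewrite (nth_map r) ?size_enum_ord // nth_ord_enum. Qed.

Lemma rows_all T (P : pred (seq nat)) : all P (rows T) = [forall r, P (trow T r)].
Proof.
apply/allP/forallP => [h r|h x /mapP[r _ ->]]; last exact: h.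
by apply: h; apply/mapP; exists r; rewrite ?mem_enum.
Qed.

Lemma size_trow T r : size (trow T r) = tnth lam r.
Proof. by rewrite size_map size_enum_ord. Qed.

Lemma nth_trow T r (c : 'I_(tnth lam r)) : nth 0 (trow T r) c = val T (mkcell c).
Proof. by rewrite (nth_map c) ?size_enum_ord // nth_ord_enum. Qed.

Lemma shape_rows T : map size (rows T) = lam.
Proof.
apply: (@eq_from_nth _ 0); first by rewrite size_map size_rows size_tuple.
move=> k; rewrite size_map size_rows => kn.
rewrite (nth_map [::]) ?size_rows // -[k]/(nat_of_ord (Ordinal kn)).
by rewrite nth_rows size_trow (tnth_nth 0).
Qed.

Lemma rows_inj T T' : rows T = rows T' -> T = T'.
Proof.
move=> e; apply/val_inj/ffunP => -[r c]; apply/val_inj.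
by have := nth_trow T c; rewrite -nth_rows e nth_rows nth_trow => /esym.
Qed.

Lemma tableau_rows T : tableau (rows T).
Proof.
apply/andP; split.
  rewrite rows_all; apply/forallP => r; apply/(sortedP 0) => j.
  rewrite size_trow => hj; have hj' := ltnW hj.
  by rewrite -[j.+1]/(val (Ordinal hj)) -[j]/(val (Ordinal hj')) !nth_trow tab_row.
apply/(sortedP [::]) => k; rewrite size_rows => hk; have hk' := ltnW hk.
rewrite -[k.+1]/(val (Ordinal hk)) -[k]/(val (Ordinal hk')) !nth_rows.
have le : tnth lam (Ordinal hk) <= tnth lam (Ordinal hk') by apply: part_le => /=.
apply/aboveP; rewrite !size_trow; split=> // j hj.
have hj' := leq_trans hj le; rewrite -[j]/(val (Ordinal hj)) nth_trow.
rewrite -[val (Ordinal hj)]/(val (Ordinal hj')) nth_trow.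
by apply: tab_col => /=.
Qed.

Lemma ntableau_rows T : ntableau n (rows T).
Proof.
apply/and3P; split; [exact: tableau_rows | by rewrite size_rows|].
by apply/allP => x /flattenP[R /mapP[r _ ->] /mapP[c _ ->]] /=.
Qed.

Lemma rows_width T : all (fun R => size R <= width lam) (rows T).
Proof.
rewrite rows_all; apply/forallP => r; rewrite size_trow leqNgt; apply/negP => h.
by have := col_lt_width (mkcell (Ordinal h)); rewrite ltnn.
Qed.

Definition tword T := colword (rows T) (width lam).

Lemma knuth_rw_tword T : knuth (rw (rows T)) (tword T).
Proof. by apply: knuth_colword (rows_width T); exact: tableau_rows. Qed.

Lemma tword_inj T T' : tword T = tword T' -> T = T'.
Proof.
move=> e; apply: rows_inj.
rewrite -(insert_colword_id (tableau_rows T) (rows_width T)).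
rewrite -(insert_colword_id (tableau_rows T') (rows_width T')).
by rewrite -!/(tword _) e !size_rows.
Qed.

Lemma enum_cell : enum {: cell lam} =
  flatten [seq [seq mkcell c | c <- enum 'I_(tnth lam r)] | r <- enum 'I_n].
Proof.
rewrite !enumT [in LHS]unlock /= /tag_enum; congr flatten.
by apply: eq_map => r; rewrite -enumT.
Qed.

Lemma tcolumn_rows T j : tcolumn (rows T) j =
  [seq nat_of_ord (val T x) | x <- enum {: cell lam} & col_of x == j].
Proof.
rewrite enum_cell /rows; elim: (enum 'I_n) => //= r s IH.
rewrite tcolumn_cons IH size_map size_enum_ord filter_cat map_cat.
rewrite filter_map /=; case: ifP => jr.
  rewrite (@eq_filter 'I_(tnth lam r) _ (pred1 (Ordinal jr))); last by move=> c; rewrite /= -val_eqE.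
  rewrite filter_pred1_uniq ?enum_uniq ?mem_enum //=; congr (_ :: _).
  by rewrite -[j]/(val (Ordinal jr)) (nth_trow T (Ordinal jr)).
rewrite (@eq_in_filter 'I_(tnth lam r) _ pred0) ?filter_pred0 // => c _ /=.
by apply/negP => /eqP cj; move: jr; rewrite -cj ltn_ord.
Qed.

Lemma mem_tcolumn T j v :
  reflect (exists2 x, col_of x = j & nat_of_ord (val T x) = v) (v \in tcolumn (rows T) j).
Proof.
rewrite tcolumn_rows; apply: (iffP mapP) => [[x]|[x xj xv]].
  by rewrite mem_filter => /andP[/eqP h _] ->; exists x.
by exists x; rewrite // mem_filter xj eqxx mem_enum.
Qed.

Definition columns T := [seq rev (tcolumn (rows T) j) | j <- iota 0 (width lam)].

Lemma sorted_columns T : all (sorted gtn) (columns T).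
Proof.
apply/allP => D /mapP[j _ ->]; rewrite rev_sorted.
exact: (tcolumn_sorted j (tableau_rows T)).
Qed.

Lemma size_columns T : size (columns T) = width lam.
Proof. by rewrite size_map size_iota. Qed.

Lemma nth_columns T j : j < width lam ->
  nth [::] (columns T) j = rev (tcolumn (rows T) j).
Proof. by move=> jw; rewrite (nth_map 0) ?size_iota // nth_iota. Qed.

Lemma count_columns T (a : 'I_n) s : uniq s ->
  count_mem (a : nat) (flatten [seq rev (tcolumn (rows T) j) | j <- s]) =
  #|[set x | (val T x == a) && (col_of x \in s)]|.
Proof.
move=> us.
transitivity (count (fun x => (val T x == a) && (col_of x \in s)) (enum {: cell lam})).
  elim: s us => [_|j s IH] /=; first by elim: (enum _) => //= x e <-; rewrite andbF.
  move=> /andP[js us]; rewrite count_cat (IH us) count_rev tcolumn_rows count_map count_filter.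
  symmetry; apply: count_split => x; rewrite /= inE -(val_eqE (val T x)) andb_orr.
  case: (_ == _) => //=; case: eqP => //= xj.
  by rewrite xj (negbTE js).
rewrite cardsE -sum1_card -sum1_count [LHS]big_enum_cond; exact: eq_bigl.
Qed.

Import Order.TTheory GRing.Theory Num.Theory.
Local Open Scope ring_scope.

Lemma hfunE T i j : hfun T i j = excess i (flatten (drop j (columns T))).
Proof.
rewrite /columns -map_drop drop_iota add0n /hfun /count_ge /excess.
rewrite -[i.+1]/(nat_of_ord (hi i)) -[X in _ - (count_mem X _)%:Z]/(nat_of_ord (lo i)).
rewrite !count_columns ?iota_uniq //; congr (Posz _ - Posz _); apply: eq_card => x.
  by rewrite !inE mem_iota; have := col_lt_width x; case: (_ == _) => //= h; apply/idP/idP; lia.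
by rewrite !inE mem_iota; have := col_lt_width x; case: (_ == _) => //= h; apply/idP/idP; lia.
Qed.

Lemma kfunE T i j : (j < width lam)%N ->
  kfun T i j = - excess i (flatten (take j.+1 (columns T))).
Proof.
move=> jw; rewrite /columns -map_take take_iota (minn_idPl jw) opprB.
rewrite -[i.+1]/(nat_of_ord (hi i)) -[X in (count_mem X _)%:Z - _]/(nat_of_ord (lo i)).
rewrite !count_columns ?iota_uniq // /kfun /count_le.
by congr (Posz _ - Posz _); apply: eq_card => x; rewrite !inE mem_iota; case: (_ == _) => //=; apply/idP/idP; lia.
Qed.

Lemma tab_epsE T i : tab_eps i T = (weps i (tword T))%:Z.
Proof.
apply/eqP; rewrite eq_le; apply/andP; split.
  apply: bigmax_le => // j _; rewrite hfunE /tword /colword -/(columns T).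
  rewrite -{2}(cat_take_drop j (columns T)) flatten_cat; exact: excess_suffix.
case E: (we i (tword T)) => [w|]; last first.
  by move/eqP: E; rewrite we_None => /eqP->; apply: bigmax_ge_id.
have [C1 [D [D' [C2 [e1 e2 e3 e4 _]]]]] := we_columns (sorted_columns T) E.
have sz : (size C1 < width lam)%N by rewrite -(size_columns T) e1 size_cat /=; lia.
apply: le_trans (le_bigmax _ (fun j : 'I_(width lam) => hfun T i j) (Ordinal sz)).
by rewrite hfunE /= e1 drop_size_cat // e4.
Qed.

Lemma tab_phiE T i : tab_phi i T = (wphi i (tword T))%:Z.
Proof.
apply/eqP; rewrite eq_le; apply/andP; split.
  apply: bigmax_le => // j _; rewrite kfunE // /tword /colword -/(columns T).
  rewrite -{2}(cat_take_drop j.+1 (columns T)) flatten_cat; exact: excess_prefix.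
case E: (wf i (tword T)) => [w|]; last first.
  by move/eqP: E; rewrite wf_None => /eqP->; apply: bigmax_ge_id.
have [C1 [D [D' [C2 [e1 e2 e3 e4 _]]]]] := wf_columns (sorted_columns T) E.
have sz : (size C1 < width lam)%N by rewrite -(size_columns T) e1 size_cat /=; lia.
apply: le_trans (le_bigmax _ (fun j : 'I_(width lam) => kfun T i j) (Ordinal sz)).
by rewrite kfunE //= e1 -cat_rcons take_size_cat ?size_rcons // e4.
Qed.

Lemma recolorE (T : tab lam) j (a b : 'I_n) :
  semistandard [ffun x => if (col_of x == j) && (val T x == a) then b else val T x] ->
  exists2 T', recolor j a b T = Some T' &
    forall j', tcolumn (rows T') j' =
      if j' == j then map (recolor_letter a b) (tcolumn (rows T) j')
      else tcolumn (rows T) j'.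
Proof.
move=> s; exists (exist (fun t => semistandard t) _ s).
  by rewrite /recolor insubT.
move=> j'; rewrite !tcolumn_rows -map_comp.
have e x : nat_of_ord (val (exist (fun t => semistandard t) _ s : tab lam) x) =
    if (col_of x == j) && (val T x == a) then nat_of_ord b else val T x.
  by rewrite /= ffunE; case: ifP.
case: eqP => jj; apply/eq_in_map => x; rewrite mem_filter => /andP[/eqP xj _]; rewrite e.
  by rewrite xj jj eqxx /= /recolor_letter val_eqE.
by rewrite xj (introF eqP jj).
Qed.

Lemma columns_split T C1 D C2 : columns T = C1 ++ D :: C2 ->
  (size C1 < width lam)%N /\ D = rev (tcolumn (rows T) (size C1)).
Proof.
move=> e; have sz : (size C1 < width lam)%N by rewrite -(size_columns T) e size_cat /=; lia.
by split=> //; rewrite -nth_columns // e nth_cat ltnn subnn.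
Qed.

Lemma columns_recolor T T' C1 D C2 (g : nat -> nat) :
  columns T = C1 ++ D :: C2 ->
  (forall j', tcolumn (rows T') j' =
    if j' == size C1 then map g (tcolumn (rows T) j') else tcolumn (rows T) j') ->
  columns T' = C1 ++ map g D :: C2.
Proof.
move=> e h; have [sz dD] := columns_split e.
apply: (@eq_from_nth _ [::]).
  by rewrite size_columns -(size_columns T) e !size_cat.
move=> j; rewrite size_columns => jw; rewrite nth_columns // h.
have := nth_columns T jw; rewrite e !nth_cat.
case: ltngtP => [jC|jC|jC] /=; last by rewrite jC subnn /= => ->; rewrite map_rev.
  by move=> ->.
by case E: (j - size C1)%N => [|k] /=; [lia | move=> ->].
Qed.

End TabRows.

(** * Crystal operators on tableaux *)

Section TabOperators.
Import Order.TTheory GRing.Theory Num.Theory.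
Variables (n : nat) (lam : n.-tuple nat).
Hypothesis hlam : sorted geq lam.
Implicit Types (T : tab lam) (i : 'I_n.-1).

Lemma count_tcolumn_gt0 T j a : (0 < count_mem a (tcolumn (rows T) j)) = (a \in tcolumn (rows T) j).
Proof. by rewrite -has_count has_pred1. Qed.

(** Within rows, the danger is an [i.+1] to the left of a lowered cell. Then the row has [i.+1] in
    column [j0 - 1] too, so by the count that column has an [i] higher up. In the row of that [i],
    the entry of column [j0] is at least [i] and less than [i.+1], but [i] is absent from column
    [j0]. *)
Lemma semistandard_lower T i j0 :
  (lo i : nat) \notin tcolumn (rows T) j0 ->
  (forall j, j.+1 = j0 -> count_mem (hi i : nat) (tcolumn (rows T) j) <=
                          count_mem (lo i : nat) (tcolumn (rows T) j)) ->
  semistandard [ffun x => if (col_of x == j0) && (val T x == hi i) then lo i else val T x].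
Proof.
move=> nlo cnt; have ncol x : col_of x = j0 -> (val T x : nat) <> i.
  by move=> xj xi; case/negP: nlo; apply/mem_tcolumn; exists x.
apply/forallP => x; apply/forallP => y; rewrite !ffunE.
apply/andP; split; apply/implyP => /andP[].
  move=> /eqP rxy cxy; have := tab_row T rxy cxy.
  case: (boolP (_ && _)) => [/andP[/eqP xj /eqP xi]|Sx].
    by rewrite xi /=; case: ifP => // _ /=; lia.
  case: ifP => // /andP[/eqP yj /eqP yi]; rewrite yi /= leq_eqVlt.
  case/orP=> [/eqP xi|//]; exfalso.
  have xj : col_of x < j0.
    rewrite -yj ltn_neqAle cxy andbT; apply: contra Sx => /eqP ->.
    by rewrite yj eqxx /=; apply/eqP/val_inj.
  case: x y rxy cxy Sx xj yj xi yi => [r c] [r' d] /= rr; subst r'.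
  rewrite /col_of /= => cd _ cj dj xi yi.
  have [j ej] : exists j, j.+1 = j0 by exists j0.-1; lia.
  have jr : j < tnth lam r by rewrite -ltnS ej -dj; apply: ltn_trans (ltn_ord d) _.
  set z := mkcell (Ordinal jr).
  have zi : (val T z : nat) = i.+1.
    have := tab_row T (x := mkcell c) (y := z) erefl; rewrite /col_of /= xi.
    have := tab_row T (x := z) (y := mkcell d) erefl; rewrite /col_of /= yi /=.
    by move=> h1 h2; have := h1 ltac:(lia); have := h2 ltac:(lia); lia.
  have : 0 < count_mem (hi i : nat) (tcolumn (rows T) j).
    by rewrite count_tcolumn_gt0; apply/mem_tcolumn; exists z.
  move=> /leq_trans/(_ (cnt j ej)); rewrite count_tcolumn_gt0.
  case/mem_tcolumn=> -[r' e]; rewrite /col_of /= => ej' ti.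
  have rr' : r' < r.
    rewrite ltnNge; apply/negP; rewrite leq_eqVlt => /orP[/eqP/val_inj err|h].
      subst r'; have ee : e = Ordinal jr by apply/val_inj.
      by move: ti zi; rewrite ee /z /mkcell => ->; lia.
    have := tab_col T (x := z) (y := Tagged _ e) h; rewrite /col_of /= ej' => /(_ erefl).
    by rewrite zi ti; lia.
  have jr' : d < tnth lam r' by apply: leq_trans (ltn_ord d) (part_le hlam (ltnW rr')).
  apply: (ncol (mkcell (Ordinal jr'))); first by rewrite /col_of /=.
  have := tab_row T (x := Tagged _ e) (y := mkcell (Ordinal jr')) erefl.
  rewrite /col_of /= ti => /(_ ltac:(lia)).
  have := tab_col T (x := mkcell (Ordinal jr')) (y := mkcell d) rr' erefl.
  by rewrite yi /=; lia.
move=> rxy /eqP cxy; have := tab_col T rxy cxy.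
case: (boolP (_ && _)) => [/andP[/eqP xj /eqP xi]|Sx].
  by rewrite xi; case: ifP => [/andP[_ /eqP ->]|_] /=; lia.
case: ifP => // /andP[/eqP yj /eqP yi]; rewrite yi /= ltnS leq_eqVlt.
by case/orP=> [/eqP xi|//]; case: (ncol x _ xi); rewrite cxy.
Qed.

(** Reflected argument: an [i] to the right of a raised cell gives an [i] in column [j0.+1] of that
    row, hence an [i.+1] further down that column, hence an [i.+1] in column [j0]. *)
Lemma semistandard_raise T i j0 :
  (hi i : nat) \notin tcolumn (rows T) j0 ->
  count_mem (lo i : nat) (tcolumn (rows T) j0.+1) <=
    count_mem (hi i : nat) (tcolumn (rows T) j0.+1) ->
  semistandard [ffun x => if (col_of x == j0) && (val T x == lo i) then hi i else val T x].
Proof.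
move=> nhi cnt; have ncol x : col_of x = j0 -> (val T x : nat) <> i.+1.
  by move=> xj xi; case/negP: nhi; apply/mem_tcolumn; exists x.
apply/forallP => x; apply/forallP => y; rewrite !ffunE.
apply/andP; split; apply/implyP => /andP[].
  move=> /eqP rxy cxy; have := tab_row T rxy cxy.
  case: (boolP (_ && _)) => [/andP[/eqP xj /eqP xi]|Sx]; last first.
    by case: ifP => // /andP[_ /eqP ->] /=; lia.
  rewrite xi; case: ifP => [/andP[_ /eqP ->] //|/negbT Sy] /=.
  rewrite leq_eqVlt => /orP[/eqP yi|//]; exfalso.
  have yj : j0 < col_of y.
    rewrite -xj ltn_neqAle cxy andbT; apply: contra Sy => /eqP <-.
    by rewrite xj eqxx /=; apply/eqP/val_inj.
  case: x y rxy cxy Sy xj yj xi yi => [r c] [r' d] /= rr; subst r'.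
  rewrite /col_of /= => cd _ cj dj xi yi.
  have jr : j0.+1 < tnth lam r by apply: leq_ltn_trans dj (ltn_ord d).
  set z := mkcell (Ordinal jr).
  have zi : (val T z : nat) = i.
    have := tab_row T (x := mkcell c) (y := z) erefl; rewrite /col_of /= xi /=.
    have := tab_row T (x := z) (y := mkcell d) erefl; rewrite /col_of /= -yi /=.
    by move=> h1 h2; have := h1 ltac:(lia); have := h2 ltac:(lia); lia.
  have : 0 < count_mem (lo i : nat) (tcolumn (rows T) j0.+1).
    by rewrite count_tcolumn_gt0; apply/mem_tcolumn; exists z.
  move=> /leq_trans/(_ cnt); rewrite count_tcolumn_gt0.
  case/mem_tcolumn=> -[r' e]; rewrite /col_of /= => ej' ti.
  have rr' : r < r'.
    rewrite ltnNge; apply/negP; rewrite leq_eqVlt => /orP[/eqP/val_inj err|h].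
      subst r'; have ee : e = Ordinal jr by apply/val_inj.
      by move: ti zi; rewrite ee /z /mkcell => ->; lia.
    have := tab_col T (x := Tagged _ e) (y := z) h; rewrite /col_of /= ej' => /(_ erefl).
    by rewrite zi ti; lia.
  have jr' : c < tnth lam r' by rewrite cj -ltnS -ej'; apply: ltn_trans (ltn_ord e) _.
  apply: (ncol (mkcell (Ordinal jr'))); first by rewrite /col_of /=.
  have := tab_row T (x := mkcell (Ordinal jr')) (y := Tagged _ e) erefl.
  rewrite /col_of /= ti => /(_ ltac:(lia)).
  have := tab_col T (x := mkcell c) (y := mkcell (Ordinal jr')) rr' erefl.
  by rewrite xi /=; lia.
move=> rxy /eqP cxy; have := tab_col T rxy cxy.
case: (boolP (_ && _)) => [/andP[/eqP xj /eqP xi]|Sx].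
  rewrite xi; case: ifP => [/andP[_ /eqP ->] /=|_ /=]; first by lia.
  by rewrite leq_eqVlt => /orP[/eqP yi|//]; case: (ncol y); rewrite -?cxy.
by case: ifP => // /andP[_ /eqP ->] /=; lia.
Qed.

Lemma tab_eE T i : omap (@tword n lam) (tab_e i T) = we i (tword T).
Proof.
case E: (we i (tword T)) => [w|]; last first.
  rewrite /tab_e; case: pickP => //= j; rewrite tab_epsE //.
  by move/eqP: E; rewrite we_None => /eqP->; rewrite ltxx.
have [C1 [D0 [D' [C2 [e1 e2 e3 e4 e5]]]]] := we_columns (sorted_columns hlam T) E.
have [sz dD] := columns_split hlam e1.
have sD : sorted gtn D0.
  by have := sorted_columns hlam T; rewrite e1 all_cat /= => /and3P[].
have [hiD loD eD'] := column_we sD e2; rewrite dD !mem_rev in hiD loD.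
have eC : drop (size C1) (columns T) = D0 :: C2 by rewrite e1 drop_size_cat.
(* The suffix that starts one column earlier has no larger excess, so the column just left of [D0]
   has excess at most 0. *)
have cnt j : j.+1 = size C1 -> count_mem (hi i : nat) (tcolumn (rows T) j) <=
                               count_mem (lo i : nat) (tcolumn (rows T) j).
  move=> ej; have jw : j < size (columns T) by rewrite size_columns; lia.
  have := excess_suffix i (flatten (take j (columns T))) (flatten (drop j (columns T))).
  rewrite -flatten_cat cat_take_drop (drop_nth [::] jw) ej e1 drop_size_cat //.
  rewrite -e1 -[flatten (_ :: _)]/(nth [::] (columns T) j ++ flatten (D0 :: C2)) excess_cat e4.
  by rewrite nth_columns -?(size_columns T) // /excess !count_rev /=; lia.
have ss := semistandard_lower loD cnt.
have [T' rT' cT'] := recolorE ss.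
have wT' : tword T' = w.
  rewrite e3 eD' -(columns_recolor hlam e1 (T' := T')) //.
rewrite /tab_e; case: pickP => [j|none].
  move=> /and3P[_ /eqP hj /forallP mx].
  have j1 : size C1 <= j.
    by have := mx (Ordinal sz); rewrite hfunE // tab_epsE // eC e4 eqxx.
  move: hj; rewrite hfunE // tab_epsE // => hj.
  have -> : nat_of_ord j = size C1; last by rewrite rT' /= wT'.
  apply/eqP; rewrite eqn_leq j1 andbT leqNgt; apply/negP => /e5.
  by rewrite hj ltxx.
have := none (Ordinal sz); rewrite tab_epsE // hfunE // eC e4.
rewrite eqxx /= => /negP[]; apply/andP; split.
  by have [-> _ _] := we_step E.
apply/forallP => j; rewrite hfunE //; apply/implyP => /eqP hj.
by rewrite leqNgt; apply/negP => /e5; rewrite hj ltxx.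
Qed.

Lemma tab_fE T i : omap (@tword n lam) (tab_f i T) = wf i (tword T).
Proof.
case E: (wf i (tword T)) => [w|]; last first.
  rewrite /tab_f; case: pickP => //= j; rewrite tab_phiE //.
  by move/eqP: E; rewrite wf_None => /eqP->; rewrite ltxx.
have [C1 [D0 [D' [C2 [e1 e2 e3 e4 e5]]]]] := wf_columns (sorted_columns hlam T) E.
have [sz dD] := columns_split hlam e1.
have sD : sorted gtn D0.
  by have := sorted_columns hlam T; rewrite e1 all_cat /= => /and3P[].
have [loD hiD eD'] := column_wf sD e2; rewrite dD !mem_rev in hiD loD.
have eC : take (size C1).+1 (columns T) = rcons C1 D0.
  by rewrite e1 -cat_rcons take_size_cat ?size_rcons.
(* The prefix that ends one column later has no larger value of k_i; beyond the width the column is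
   empty. *)
have cnt : count_mem (lo i : nat) (tcolumn (rows T) (size C1).+1) <=
           count_mem (hi i : nat) (tcolumn (rows T) (size C1).+1).
  have [jw|jw] := ltnP (size C1).+1 (width lam); last first.
    suff -> : tcolumn (rows T) (size C1).+1 = [::] by [].
    apply/eqP; rewrite -[_ == _]negbK; apply/negP => /eqP.
    case: tcolumn (@mem_tcolumn _ _ T (size C1).+1) => // v s /(_ v).
    rewrite mem_head => h _; have /h[x xj _] := isT.
    by have := col_lt_width hlam x; lia.
  have jw' : (size C1).+1 < size (columns T) by rewrite size_columns.
  have := excess_prefix i (flatten (take (size C1).+2 (columns T)))
                          (flatten (drop (size C1).+2 (columns T))).
  rewrite -flatten_cat cat_take_drop (take_nth [::] jw') eC flatten_rcons.
  rewrite excess_cat opprD e4 nth_columns // /excess !count_rev /=; lia.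
have ss := semistandard_raise hiD cnt.
have [T' rT' cT'] := recolorE ss.
have wT' : tword T' = w.
  rewrite e3 eD' -(columns_recolor hlam e1 (T' := T')) //.
rewrite /tab_f; case: pickP => [j|none].
  move=> /and3P[_ /eqP hj /forallP mx].
  have j1 : j <= size C1.
    by have := mx (Ordinal sz); rewrite kfunE // tab_phiE // eC e4 eqxx.
  move: hj; rewrite kfunE // tab_phiE // => hj.
  have -> : nat_of_ord j = size C1; last by rewrite rT' /= wT'.
  apply/eqP; rewrite eqn_leq j1 /= leqNgt; apply/negP => /e5.
  by rewrite hj ltxx.
have := none (Ordinal sz); rewrite tab_phiE // kfunE // eC e4.
rewrite eqxx /= => /negP[]; apply/andP; split.
  by have [_ -> _] := we_step (wf_step E).
apply/forallP => j; rewrite kfunE //; apply/implyP => /eqP hj.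
by rewrite leqNgt; apply/negP => /e5; rewrite hj ltxx.
Qed.

End TabOperators.

(** * Jeu de taquin preserves the Knuth class *)

(* The letters of Q' are inserted in the row P Q S and bump those of Q. *)
Lemma knuth_insert_row P Q S Q' : all2 ltn Q' Q ->
  sorted leq (P ++ Q ++ S) -> sorted leq (P ++ Q') ->
  knuth (P ++ Q ++ S ++ Q') (Q ++ P ++ Q' ++ S).
Proof.
elim: Q Q' P => [|q Q IH] [|q' Q'] P //=.
  by rewrite !cats0 => _ _ _; exact: knuth_refl.
move=> /andP[qq QQ] sPQ sPQ'.
have Pq : sorted leq (rcons P q').
  by move: sPQ'; rewrite -cat_rcons => /cat_sorted2[].
apply: (@knuth_trans (q :: rcons P q' ++ Q ++ S ++ Q')).
  have := knuth_catr Q' (knuth_bump sPQ Pq qq).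
  by rewrite -?cats1 -?catA /= -?catA /= -?catA /=.
have s3 : sorted leq (P ++ q' :: Q ++ S).
  apply: sorted_replace sPQ _ (ltnW qq).
  by move: Pq; rewrite sorted_rcons_leq => /andP[].
have := IH Q' (rcons P q') QQ; rewrite !cat_rcons => h.
exact: (knuth_catl [:: q] (h s3 sPQ')).
Qed.

(* The row words before and after y moves up; A1 lies below A' and B below B1. *)
Lemma knuth_move_up A0 A1 y B A' B1 B2 : all2 ltn A' A1 -> all2 ltn B1 B ->
  sorted leq (A1 ++ y :: B) -> sorted leq (A' ++ y :: B1) ->
  knuth ((A0 ++ A1 ++ y :: B) ++ A' ++ B1 ++ B2)
        ((A0 ++ A1 ++ B) ++ A' ++ y :: B1 ++ B2).
Proof.
move=> hA hB s1 s2; rewrite -!catA; apply: knuth_catl.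
have sA : sorted leq A' by have [] := cat_sorted2 s2.
have h1 := @knuth_insert_row [::] A1 (y :: B) A' hA s1 sA.
have sB : sorted leq ((A' ++ [:: y]) ++ B ++ [::]).
  rewrite cats0 -catA /= sorted_cat_leq.
  move: s1 s2; rewrite !sorted_cat_leq !sorted_cons_leq.
  move=> /and3P[_ _ /andP[yB sB]] /and3P[AyB sA' _].
  have Ay : all (geq y) A'.
    by apply/allP => x xA; apply: (allrelP AyB) => //; rewrite mem_head.
  by rewrite sA' sB yB andbT (@allrel_leq_trans A' y) //= leqnn.
have h2 := @knuth_insert_row (A' ++ [:: y]) B [::] B1 hB sB.
(* Inserting [A'] bumps [A1] out of [A1 ++ y :: B]; inserting [B1] then bumps [B] out of
   [A' ++ y :: B]. *)
apply: (@knuth_trans (A1 ++ A' ++ y :: B ++ B1 ++ B2)).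
  by have := knuth_catr (B1 ++ B2) h1; rewrite -?catA /= -?catA.
by apply: knuth_catl; have := knuth_catr B2 (h2 _); rewrite -?catA /= -?catA; apply.
Qed.

(** The hole is a parameter, so that one invariant serves during a slide ([at_cell]) and between
    slides ([no_hole]). The order conditions compare any two occupied cells, hence also cells on
    opposite sides of the hole. *)
Record skew_filling (m l : nat -> nat) (hole : rel nat) (F : filling) :
    Prop := SkewFilling {
  sk_supp : forall r c, isSome (F r c) = (m r <= c < l r) && ~~ hole r c;
  sk_inner : forall r s, r <= s -> m s <= m r;
  sk_outer : forall r s, r <= s -> l s <= l r;
  sk_le : forall r, m r <= l r;
  sk_row : forall r c d x y, F r c = Some x -> F r d = Some y -> c <= d -> x <= y;
  sk_col : forall r s c x y, F r c = Some x -> F s c = Some y -> r < s -> x < y }.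

(** Empty cells are dropped, so a horizontal move does not change these rows
    ([slide_right_rows]). *)
Definition frows (F : filling) (N M : nat) : seq (seq nat) :=
  [seq pmap (F r) (iota 0 M) | r <- iota 0 N].

Definition fval (F : filling) r c := odflt 0 (F r c).

Lemma pmap_filter_isSome (X Y : Type) (y0 : Y) (f : X -> option Y) s :
  pmap f s = [seq odflt y0 (f x) | x <- s & isSome (f x)].
Proof. by elim: s => //= x s IH; case E: (f x) => [y|] /=; rewrite IH ?E. Qed.

Lemma pmap_iota (F : filling) r M s : sorted ltn s ->
  (forall c, (c \in s) = (c < M) && F r c) -> pmap (F r) (iota 0 M) = map (fval F r) s.
Proof.
move=> ss hs; rewrite (pmap_filter_isSome 0); congr map.
apply: (irr_sorted_eq ltn_trans ltnn) => //.
  by apply: (sorted_filter ltn_trans); exact: iota_ltn_sorted.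
by move=> c; rewrite mem_filter mem_iota hs andbC.
Qed.

Lemma sorted_iota_cat a k b l : a + k <= b -> sorted ltn (iota a k ++ iota b l).
Proof.
move=> h; rewrite (sorted_pairwise ltn_trans) pairwise_cat.
rewrite -!(sorted_pairwise ltn_trans) !iota_ltn_sorted !andbT.
by apply/allrelP => x y; rewrite !mem_iota; lia.
Qed.

Lemma sorted_fval m l h F r s : skew_filling m l h F -> sorted ltn s ->
  (forall c, c \in s -> F r c) -> sorted leq (map (fval F r) s).
Proof.
move=> sk ss hs; rewrite sorted_map.
apply: (@sub_in_sorted _ (mem s) ltn) ss; last exact/allP.
move=> c d /hs Fc /hs Fd /ltnW cd; rewrite /= /fval.
case E1: (F r c) Fc => [x|//] _; case E2: (F r d) Fd => [y|//] _ /=.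
exact: (sk_row sk E1 E2 cd).
Qed.

Lemma all2_fval m l h F r r' s : skew_filling m l h F -> r < r' ->
  (forall c, c \in s -> F r c && F r' c) ->
  all2 ltn (map (fval F r) s) (map (fval F r') s).
Proof.
move=> sk rr hs; elim: s hs => //= c s IH hs.
rewrite IH ?andbT; last by move=> d ds; apply: hs; rewrite inE ds orbT.
have /andP[] := hs c (mem_head _ _); rewrite /fval.
case E1: (F r c) => [x|//] _; case E2: (F r' c) => [y|//] _ /=.
by rewrite (sk_col sk E1 E2 rr).
Qed.

Lemma frows_split (F : filling) N M r : r.+1 < N ->
  rw (frows F N M) = rw [seq pmap (F k) (iota 0 M) | k <- iota r.+2 (N - r.+2)] ++
    (pmap (F r.+1) (iota 0 M) ++ pmap (F r) (iota 0 M)) ++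
    rw [seq pmap (F k) (iota 0 M) | k <- iota 0 r].
Proof.
move=> rN; rewrite /frows -{1}(subnKC rN) iotaD map_cat rw_cat; congr (_ ++ _).
have -> : r.+2 = r + 2 by lia.
by rewrite iotaD map_cat rw_cat add0n /= !rw_cons.
Qed.

Definition at_cell (r c p q : nat) : bool := (p == r) && (q == c).
Definition no_hole (p q : nat) : bool := false.
Arguments at_cell r c p q /.
Arguments no_hole p q /.

Lemma slide_right_skew m l F r c x :
  skew_filling m l (at_cell r c) F -> m r <= c < l r -> F r c.+1 = Some x ->
  (forall y, F r.+1 c = Some y -> x < y) ->
  skew_filling m l (at_cell r c.+1) (move_entry F r c r c.+1) /\
  m r <= c.+1 < l r.
Proof.
move=> [supp inn out ml row col] rc Fx hx.
have hc : m r <= c.+1 < l r by have := supp r c.+1; rewrite Fx /= => /esym/andP[].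
(* Column [c] once [x] is in it: an entry above is at most its right neighbour, which lies above the
   old place of [x]; an entry below is at least the lower neighbour of the hole, which exceeds
   [x]. *)
have Fr p : F p c -> p <> r -> exists2 b, F p c = Some b & if p < r then b < x else x < b.
  case E: (F p c) => [b|//] _ pr; exists b => //; have := supp p c; rewrite E /= => /esym/andP[pc _].
  case: ltnP => h.
    have : F p c.+1 by rewrite supp /=; have := inn _ _ (ltnW h); have := out _ _ (ltnW h); lia.
    case E': (F p c.+1) => [d|//] _.
    by apply: leq_ltn_trans (row _ _ _ _ _ E E' (leqnSn _)) (col _ _ _ _ _ E' Fx h).
  have h' : r.+1 <= p by lia.
  have : F r.+1 c.
    by rewrite supp /=; have := inn _ _ (leqnSn r); have := out _ _ h'; lia.
  case E': (F r.+1 c) => [d|//] _; have xd := hx _ E'.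
  move: h'; rewrite leq_eqVlt => /orP[/eqP rp|h'].
    by move: E; rewrite -rp E' => -[<-].
  exact: ltn_trans xd (col _ _ _ _ _ E' E h').
split=> //; split=> // [p q|p q d u v|p p' q u v]; rewrite /move_entry.
- case: ifP => [/andP[/eqP-> /eqP->]|h1]; first by rewrite Fx /=; lia.
  by case: ifP => [/andP[/eqP-> /eqP->]|h2]; rewrite ?supp /=; lia.
- have Frow q' a : F r q' = Some a -> q' <> c.+1 ->
    if q' <= c then a <= x else x <= a.
    by case: leqP => h E ne; [apply: row E Fx _ | apply: row Fx E _]; lia.
  case: ifP => [/andP[/eqP-> /eqP->]|h1].
    rewrite Fx => -[<-]; rewrite eqxx /=; case: eqP => [_ [->]//|dc].
    case: eqP => // dc1 Fd cd; have := Frow _ _ Fd dc1; case: leqP => //; lia.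
  case: ifP => // h2 Fu; case: ifP => [/andP[/eqP pr /eqP->]|h3].
    rewrite Fx => -[<-] qc; subst p.
    by have := Frow _ _ Fu; rewrite qc; apply; lia.
  by case: ifP => // h4 Fv; apply: row Fu Fv.
- case: ifP => [/andP[/eqP-> /eqP->]|h1].
    rewrite Fx => -[<-]; case: ifP => [/andP[/eqP-> _]|h2]; first by lia.
    case: ifP => // h3 Fv rp; have := Fr p'; rewrite Fv => /(_ isT ltac:(lia))[b [<-]].
    by rewrite ltnNge (ltnW rp).
  case: ifP => // h2 Fu; case: ifP => [/andP[/eqP-> /eqP qc]|h3].
    rewrite Fx => -[<-] pr; have := Fr p; rewrite -qc Fu => /(_ isT ltac:(lia))[b [<-]].
    by rewrite pr.
  by case: ifP => // h4 Fv; apply: col Fu Fv.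
Qed.

Lemma slide_up_skew m l F r c y :
  skew_filling m l (at_cell r c) F -> m r <= c < l r -> F r.+1 c = Some y ->
  (forall x, F r c.+1 = Some x -> y <= x) ->
  skew_filling m l (at_cell r.+1 c) (move_entry F r c r.+1 c) /\
  m r.+1 <= c < l r.+1.
Proof.
move=> [supp inn out ml row col] rc Fy hy.
have hc : m r.+1 <= c < l r.+1 by have := supp r.+1 c; rewrite Fy /= => /esym/andP[].
(* Row [r] once [y] is in it: an entry to the left is less than the one below it, which is at most
   [y]; an entry to the right is at least the right neighbour of the hole. *)
have Fr q : F r q -> q <> c -> exists2 b, F r q = Some b & if q < c then b <= y else y <= b.
  case E: (F r q) => [b|//] _ qc; exists b => //; have := supp r q; rewrite E /= => /esym/andP[rq _].
  case: ltnP => h.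
    have : F r.+1 q by rewrite supp /=; have := inn _ _ (leqnSn r); lia.
    case E': (F r.+1 q) => [d|//] _.
    by apply: leq_trans (ltnW (col _ _ _ _ _ E E' (leqnn _))) (row _ _ _ _ _ E' Fy (ltnW h)).
  have : F r c.+1 by rewrite supp /=; lia.
  case E': (F r c.+1) => [d|//] _.
  by apply: leq_trans (hy _ E') (row _ _ _ _ _ E' E _); lia.
split=> //; split=> // [p q|p q d u v|p p' q u v]; rewrite /move_entry.
- case: ifP => [/andP[/eqP-> /eqP->]|h1]; first by rewrite Fy /=; lia.
  by case: ifP => [/andP[/eqP-> /eqP->]|h2]; rewrite ?supp /=; lia.
- case: ifP => [/andP[/eqP-> /eqP->]|h1].
    rewrite Fy => -[<-]; case: ifP => [/andP[_ /eqP->] [->]//|h2].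
    case: ifP => // h3 Fv cd; have := Fr d; rewrite Fv => /(_ isT ltac:(lia))[b [<-]].
    by rewrite ltnNge cd.
  case: ifP => // h2 Fu; case: ifP => [/andP[/eqP pr /eqP->]|h3].
    rewrite Fy => -[<-] qc; subst p; have := Fr q; rewrite Fu => /(_ isT ltac:(lia))[b [<-]].
    by case: ltnP => //; lia.
  by case: ifP => // h4 Fv; apply: row Fu Fv.
- have Fcol p0 a : F p0 c = Some a -> p0 <> r.+1 -> if p0 <= r then a < y else y < a.
    by case: (leqP p0 r) => h E ne; [apply: col E Fy _ | apply: col Fy E _]; lia.
  case: ifP => [/andP[/eqP-> /eqP->]|h1].
    rewrite Fy => -[<-]; case: ifP => [/andP[/eqP-> _]|h2]; first by lia.
    case: ifP => // h3 Fv rp; have := Fcol _ _ Fv; case: (leqP p' r) => h; first by lia.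
    by apply; lia.
  case: ifP => // h2 Fu; case: ifP => [/andP[/eqP-> /eqP qc]|h3].
    rewrite Fy => -[<-] pr; move: Fu; rewrite qc => /Fcol; rewrite (ltnW pr).
    by apply; lia.
  by case: ifP => // h4 Fv; apply: col Fu Fv.
Qed.

(** Without a right or lower neighbour the hole is an outer corner, so it can be cut off from the
    outer shape. *)
Lemma slide_stop_skew m l F r c : skew_filling m l (at_cell r c) F ->
  m r <= c < l r -> F r c.+1 = None -> F r.+1 c = None ->
  skew_filling m (fun s => if s == r then c else l s) no_hole F.
Proof.
move=> [supp inn out ml row col] rc Fx Fy.
have lr : l r = c.+1 by have := supp r c.+1; rewrite Fx /=; lia.
have lr1 : l r.+1 <= c.
  by have := supp r.+1 c; rewrite Fy /=; have := inn _ _ (leqnSn r); lia.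
split=> //.
- by move=> p q; rewrite supp /=; case: eqP => [->|] /=; lia.
- move=> p q pq; case: eqP => [qr|qr]; case: eqP => [pr|pr] //; last exact: out.
    by have := out p q pq; rewrite qr lr; lia.
  by apply: leq_trans (out r.+1 q _) lr1; lia.
- by move=> p; case: eqP => [->|_] //; lia.
Qed.

Lemma slide_right_rows (F : filling) N M r c : F r c = None -> F r c.+1 -> c.+1 < M ->
  frows (move_entry F r c r c.+1) N M = frows F N M.
Proof.
move=> Fc Fx cM; apply: eq_map => k.
case: (eqVneq k r) => [->|/negbTE kr]; last first.
  by apply: eq_pmap => q; rewrite /move_entry kr.
have eq_out s : (forall q, q \in s -> q <> c /\ q <> c.+1) ->
    pmap (move_entry F r c r c.+1 r) s = pmap (F r) s.
  move=> h; apply: eq_in_pmap => q /h[q1 q2]; rewrite /move_entry !eqxx /=.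
  by do 2 case: eqP => // _.
have -> : M = c + (2 + (M - c - 2)) by lia.
rewrite !iotaD !pmap_cat add0n (eq_out (iota 0 c)) ?(eq_out (iota (c + 2) _)).
- congr (_ ++ (_ ++ _)); rewrite /= /move_entry !eqxx /= Fc.
  have cc : (c.+1 == c) = false by lia.
  by rewrite cc /=; case: (F r c.+1).
- by move=> q; rewrite mem_iota; lia.
- by move=> q; rewrite mem_iota; lia.
Qed.

Lemma slide_up_rows m l F N M r c y :
  skew_filling m l (at_cell r c) F -> m r <= c < l r -> F r.+1 c = Some y ->
  (forall x, F r c.+1 = Some x -> y <= x) ->
  (forall s, l s <= M) -> (forall s, N <= s -> l s = 0) ->
  knuth (rw (frows F N M)) (rw (frows (move_entry F r c r.+1 c) N M)).
Proof.
move=> sk rc Fy hy lM lN; have [sk' rc'] := slide_up_skew sk rc Fy hy.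
set F1 := move_entry F r c r.+1 c in sk' *.
have rN : r.+1 < N by rewrite ltnNge; apply/negP => /lN; lia.
rewrite !(frows_split _ _ rN).
have oth s : {in s, forall k, k <> r /\ k <> r.+1} ->
    [seq pmap (F1 k) (iota 0 M) | k <- s] = [seq pmap (F k) (iota 0 M) | k <- s].
  move=> h; apply/eq_in_map => k /h[k1 k2]; apply: eq_pmap => q.
  by rewrite /F1 /move_entry (introF eqP k1) (introF eqP k2).
rewrite !oth; [|by move=> k; rewrite mem_iota; lia|by move=> k; rewrite mem_iota; lia].
apply: knuth_catl; apply: knuth_catr.
have [supp inn out ml _ _] := sk; have [supp' _ _ _ _ _] := sk'.
have mr := inn _ _ (leqnSn r); have lr := out _ _ (leqnSn r).
have lMr := lM r; have lMr1 := lM r.+1.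
(* The pieces of [knuth_move_up]: [s0] are the columns on the left met only by row [r.+1], [s1] and
   [s2] the common columns before and after [c], and [s3] the columns on the right met only by row
   [r]. *)
pose s0 := iota (m r.+1) (m r - m r.+1); pose s1 := iota (m r) (c - m r).
pose s2 := iota c.+1 (l r.+1 - c.+1); pose s3 := iota (l r.+1) (l r - l r.+1).
have e1 : s0 ++ s1 = iota (m r.+1) (c - m r.+1).
  by rewrite /s0 /s1 -{2}(subnKC mr) -iotaD; congr iota; lia.
have e2 : c :: s2 = iota c (l r.+1 - c).
  by rewrite /s2 -[c :: _]/(iota c (l r.+1 - c.+1).+1); congr iota; lia.
have e3 : s2 ++ s3 = iota c.+1 (l r - c.+1).
  rewrite /s2 /s3 -{2}(subnKC (_ : c < l r.+1)); last lia.
  by rewrite -iotaD; congr iota; lia.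
have e4 : s1 ++ c :: s2 = iota (m r) (l r.+1 - m r).
  by rewrite e2 /s1 -{2}(subnKC (_ : m r <= c)) -?iotaD; [congr iota|]; lia.
have e5 : s0 ++ s1 ++ c :: s2 = iota (m r.+1) (l r.+1 - m r.+1).
  by rewrite e4 /s0 -{2}(subnKC mr) -iotaD; congr iota; lia.
have v1 q : q != c -> fval F1 r.+1 q = fval F r.+1 q.
  by move=> /negbTE qc; rewrite /fval /F1 /move_entry qc !andbF.
have v0 q : q != c -> fval F1 r q = fval F r q.
  by move=> /negbTE qc; rewrite /fval /F1 /move_entry qc !andbF.
have v0c : fval F1 r c = y by rewrite /fval /F1 /move_entry !eqxx /= Fy.
have v1c : fval F r.+1 c = y by rewrite /fval Fy.
have mapv1 s : c \notin s -> map (fval F1 r.+1) s = map (fval F r.+1) s.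
  by move=> h; apply/eq_in_map => q qs; apply: v1; apply: contraNneq h => <-.
have mapv0 s : c \notin s -> map (fval F1 r) s = map (fval F r) s.
  by move=> h; apply/eq_in_map => q qs; apply: v0; apply: contraNneq h => <-.
have c0 : c \notin s0 by rewrite mem_iota; lia.
have c1 : c \notin s1 by rewrite mem_iota; lia.
have c2 : c \notin s2 by rewrite mem_iota; lia.
have c3 : c \notin s3 by rewrite mem_iota; lia.
have in1 q : q \in s1 -> m r <= q < c by rewrite mem_iota; lia.
have in2 q : q \in s2 -> c < q < l r.+1 by rewrite mem_iota; lia.
rewrite (@pmap_iota F r.+1 M (s0 ++ s1 ++ c :: s2)); last 2 first.
- by rewrite e5; exact: iota_ltn_sorted.
- by move=> q; rewrite e5 mem_iota supp /=; lia.
rewrite (@pmap_iota F r M (s1 ++ s2 ++ s3)); last 2 first.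
- by rewrite e3; apply: sorted_iota_cat; lia.
- by move=> q; rewrite e3 mem_cat !mem_iota supp /=; lia.
rewrite (@pmap_iota F1 r.+1 M (s0 ++ s1 ++ s2)); last 2 first.
- by rewrite catA e1; apply: sorted_iota_cat; lia.
- by move=> q; rewrite catA e1 mem_cat !mem_iota supp' /=; lia.
rewrite (@pmap_iota F1 r M (s1 ++ c :: s2 ++ s3)); last 2 first.
- rewrite e3 -[c :: _]/(iota c (l r - c.+1).+1); apply: sorted_iota_cat; lia.
- by move=> q; rewrite e3 mem_cat inE !mem_iota supp' /=; lia.
rewrite !(map_cat, map_cons) v0c v1c !mapv1 // !mapv0 //.
apply: knuth_move_up.
- by apply: (all2_fval sk (ltnSn r)) => q /in1; rewrite !supp /=; lia.
- by apply: (all2_fval sk (ltnSn r)) => q /in2; rewrite !supp /=; lia.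
- rewrite -v1c -map_cons -map_cat e4; apply: (sorted_fval sk (iota_ltn_sorted _ _)).
  by move=> q; rewrite mem_iota supp /=; lia.
- rewrite -(mapv0 s1) // -(mapv0 s2) // -v0c -map_cons -map_cat e4.
  apply: (sorted_fval sk' (iota_ltn_sorted _ _)).
  by move=> q; rewrite mem_iota supp' /=; lia.
Qed.

(** The bound on [l'] keeps the result inside the same [N] by [M] box, so that slides can be
    chained. *)
Lemma slide_knuth F r c F' : slide F r c F' -> forall m l N M,
  skew_filling m l (at_cell r c) F -> m r <= c < l r ->
  (forall s, l s <= M) -> (forall s, N <= s -> l s = 0) ->
  exists l', [/\ skew_filling m l' no_hole F', forall s, l' s <= l s &
                 knuth (rw (frows F N M)) (rw (frows F' N M))].
Proof.
elim=> {F r c F'} [F r c Fx Fy|F r c x F' Fx hx _ IH|F r c y F' Fy hy _ IH] m l N M sk rc lM lN.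
- exists (fun s => if s == r then c else l s); split; first exact: slide_stop_skew.
    by move=> s; case: eqP => // ->; lia.
  exact: knuth_refl.
- have [sk' rc'] := slide_right_skew sk rc Fx hx.
  have [l' [h1 h2 h3]] := IH m l N M sk' rc' lM lN; exists l'; split=> //.
  rewrite slide_right_rows // in h3; first by have := sk_supp sk r c; rewrite /= !eqxx andbF; case: (F r c).
    by rewrite Fx.
  by have := lM r; lia.
- have [sk' rc'] := slide_up_skew sk rc Fy hy.
  have [l' [h1 h2 h3]] := IH m l N M sk' rc' lM lN; exists l'; split=> //.
  exact: knuth_trans (slide_up_rows sk rc Fy hy lM lN) h3.
Qed.

(** * Rectification: Knuth invariance and existence *)

Definition shrink (m : nat -> nat) r := fun s => if s == r then (m r).-1 else m s.

Lemma skew_corner m l F r : skew_filling m l no_hole F -> m r.+1 < m r ->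
  skew_filling (shrink m r) l (at_cell r (m r).-1) F /\
  shrink m r r <= (m r).-1 < l r.
Proof.
move=> [supp inn out ml row col] mr; have := ml r => mlr.
rewrite /shrink eqxx; split; last by lia.
split=> //.
- by move=> p q; rewrite supp /=; case: eqP => [->|]; lia.
- move=> p q pq; case: eqP => [qr|qr]; case: eqP => [pr|pr] //.
  + by have := inn p q pq; rewrite qr; lia.
  + by have := inn r.+1 q ltac:(lia); lia.
  + exact: inn.
- by move=> p; case: eqP => [->|_] //; lia.
Qed.

Lemma rectifies_knuth m F F' : rectifies m F F' -> forall l N M,
  skew_filling m l no_hole F ->
  (forall s, l s <= M) -> (forall s, N <= s -> l s = 0) ->
  exists l', [/\ skew_filling (fun=> 0) l' no_hole F', forall s, l' s <= l s &
                 knuth (rw (frows F N M)) (rw (frows F' N M))].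
Proof.
elim=> {m F F'} [m F m0|m F F1 F' r mr sl _ IH] l N M sk lM lN.
  exists l; split=> //; last exact: knuth_refl.
  by case: sk => [supp inn out ml row col]; split=> // p q; rewrite supp m0.
have [sk1 rc] := skew_corner sk mr.
have [l1 [h1 h2 h3]] := slide_knuth sl sk1 rc lM lN.
have [l2 [k1 k2 k3]] := IH l1 N M h1 (fun s => leq_trans (h2 s) (lM s))
  (fun s hs => ltac:(by apply/eqP; rewrite -leqn0 -(lN s hs))).
exists l2; split=> //; first by move=> s; exact: leq_trans (k2 s) (h2 s).
exact: knuth_trans h3 k3.
Qed.

Lemma slide_exists F r c m l N M :
  skew_filling m l (at_cell r c) F -> m r <= c < l r ->
  (forall s, l s <= M) -> (forall s, N <= s -> l s = 0) ->
  exists F', slide F r c F'.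
Proof.
(* The hole only moves right or down inside the box. *)
have [k] := ubnP (N - r + (M - c)); elim: k F r c => // k IH F r c ltk sk rc lM lN.
have rN : r < N by rewrite ltnNge; apply/negP => /lN; lia.
have cM : c < M by have := lM r; lia.
have right x : F r c.+1 = Some x -> (forall y, F r.+1 c = Some y -> x < y) ->
    exists F', slide F r c F'.
  move=> Fx hx; have [sk' rc'] := slide_right_skew sk rc Fx hx.
  have [F' h] := IH _ r c.+1 ltac:(lia) sk' rc' lM lN.
  by exists F'; exact: slide_right Fx hx h.
have up y : F r.+1 c = Some y -> (forall x, F r c.+1 = Some x -> y <= x) ->
    exists F', slide F r c F'.
  move=> Fy hy; have [sk' rc'] := slide_up_skew sk rc Fy hy.
  have [F' h] := IH _ r.+1 c ltac:(lia) sk' rc' lM lN.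
  by exists F'; exact: slide_up Fy hy h.
case Fx: (F r c.+1) => [x|]; case Fy: (F r.+1 c) => [y|].
- have [yx|xy] := leqP y x; first by apply: (up y) => // z; rewrite Fx => -[<-].
  by apply: (right x) => // z; rewrite Fy => -[<-].
- by apply: (right x) => // z; rewrite Fy.
- by apply: (up y) => // z; rewrite Fx.
- by exists F; apply: slide_stop.
Qed.

Lemma rectifies_exists F m l N M : skew_filling m l no_hole F ->
  (forall s, l s <= M) -> (forall s, N <= s -> l s = 0) ->
  exists F', rectifies m F F'.
Proof.
have [k] := ubnP (\sum_(s < N) m s); elim: k F m l => // k IH F m l ltk sk lM lN.
have mN s : N <= s -> m s = 0.
  by move=> /lN l0; apply/eqP; rewrite -leqn0 -l0; exact: (sk_le sk).
have [/existsP[r mr]|h] := boolP [exists r : 'I_N, m r.+1 < m r]; last first.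
  exists F; apply: rectifies_done.
  (* Without a corner the inner row lengths never drop from one row to the next, yet they vanish
     from row [N] on. *)
  have h0 d r : N <= r + d -> m r = 0.
    elim: d r => [|d IHd] r; first by rewrite addn0; exact: mN.
    have [Nr|rN] := leqP N r; first by move=> _; exact: mN.
    rewrite addnS -addSn => /IHd mr1; move: h; rewrite negb_exists => /forallP/(_ (Ordinal rN)).
    by rewrite mr1 -eqn0Ngt /= => /eqP.
  by move=> r; apply: (h0 N); lia.
have [sk1 rc] := skew_corner sk mr.
have [F1 sl] := slide_exists sk1 rc lM lN.
have [l1 [h1 h2 h3]] := slide_knuth sl sk1 rc lM lN.
have [|F' hF] := IH F1 (shrink m r) l1 _ h1 (fun s => leq_trans (h2 s) (lM s))
  (fun s hs => ltac:(by apply/eqP; rewrite -leqn0 -(lN s hs))); last first.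
  by exists F'; apply: rectifies_step mr sl hF.
move: ltk; rewrite (bigD1 r) //= [X in _ -> X < _](bigD1 r) //= {1}/shrink eqxx.
have -> : \sum_(s < N | s != r) shrink m r s = \sum_(s < N | s != r) m s; last first.
  by move=> h; rewrite -ltnS; apply: leq_trans h; rewrite !ltnS ltn_add2r; lia.
by apply: eq_bigr => s sr; rewrite /shrink ifN // val_eqE.
Qed.

(** * The rectification of T * U *)

Lemma sorted_geq_nth (s : seq nat) i j : sorted geq s -> i <= j -> nth 0 s j <= nth 0 s i.
Proof.
move=> ss ij; have [js|sj] := ltnP j (size s); last by rewrite nth_default.
have tr : transitive geq by move=> y x z h1 h2; apply: leq_trans h2 h1.
by apply: (sorted_leq_nth tr leqnn 0 ss) => //; rewrite inE; lia.
Qed.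

Lemma tab_fillingP n (nu : n.-tuple nat) (V : tab nu) r c x :
  tab_filling V r c = Some x ->
  exists z : cell nu, [/\ nat_of_ord (row_of z) = r, col_of z = c & x = val V z].
Proof.
rewrite /tab_filling; case: insubP => // r' _ <-; case: insubP => // c' _ <- [<-].
by exists (mkcell c').
Qed.

Lemma size_nth_rows n (nu : n.-tuple nat) (V : tab nu) r :
  size (nth [::] (rows V) r) = nth 0 nu r.
Proof.
have [rn|rn] := ltnP r n; first by rewrite -(shape_rows V) (nth_map [::]) // size_rows.
by rewrite !nth_default // ?size_rows // size_tuple.
Qed.

Lemma tab_fillingE n (nu : n.-tuple nat) (V : tab nu) r c :
  tab_filling V r c =
  if c < nth 0 nu r then Some (nth 0 (nth [::] (rows V) r) c) else None.
Proof.
rewrite /tab_filling; case: insubP => [r' _ <-|]; last first.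
  by rewrite -leqNgt => nr; rewrite [nth 0 _ _]nth_default // size_tuple.
rewrite nth_rows -tnth_nth; case: insubP => [c' _ <-|].
  by rewrite ltn_ord nth_trow.
by rewrite -leqNgt ltnNge => ->.
Qed.

Lemma pmap_tab_filling n (nu : n.-tuple nat) (V : tab nu) r M : nth 0 nu r <= M ->
  pmap (tab_filling V r) (iota 0 M) = nth [::] (rows V) r.
Proof.
move=> h; rewrite (@pmap_iota _ _ _ (iota 0 (nth 0 nu r))) ?iota_ltn_sorted //; last first.
  by move=> c; rewrite mem_iota tab_fillingE; case: ifP => /=; lia.
apply: (@eq_from_nth _ 0); first by rewrite size_map size_iota size_nth_rows.
move=> c; rewrite size_map size_iota => hc.
by rewrite (nth_map 0) ?size_iota // nth_iota // /fval tab_fillingE hc.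
Qed.

Lemma tableau_frows l F N M : skew_filling (fun=> 0) l no_hole F -> (forall s, l s <= M) ->
  tableau (frows F N M).
Proof.
move=> sk lM; have e r : pmap (F r) (iota 0 M) = map (fval F r) (iota 0 (l r)).
  apply: pmap_iota; first exact: iota_ltn_sorted.
  by move=> c; rewrite mem_iota (sk_supp sk) /=; have := lM r; lia.
apply/andP; split.
  apply/allP => R /mapP[r _ ->]; rewrite e; apply: (sorted_fval sk (iota_ltn_sorted _ _)).
  by move=> c; rewrite mem_iota (sk_supp sk) /=; lia.
apply/(sortedP [::]) => k; rewrite size_map size_iota => kN.
rewrite !(nth_map 0) ?size_iota ?(ltnW kN) // !nth_iota ?(ltnW kN) // !add0n !e.
apply/aboveP; rewrite !size_map !size_iota; split; first exact: (sk_outer sk).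
have lk := sk_outer sk (leqnSn k).
move=> j hj; rewrite !(nth_map 0) ?size_iota ?nth_iota //; try lia.
rewrite !add0n.
have : F k j by rewrite (sk_supp sk) /=; lia.
have : F k.+1 j by rewrite (sk_supp sk) /=; lia.
rewrite /fval; case E1: (F _ _) => [x|//] _; case E2: (F _ _) => [y|//] _ /=.
by rewrite (sk_col sk E2 E1).
Qed.

Lemma tableau_cat_nil t k : tableau t -> tableau (t ++ nseq k [::]).
Proof.
elim: t => [|R t IH]; first by move=> _; have /and3P[] := ntableau_nil k.
rewrite cat_cons !tableau_cons => /and3P[-> Rt tt]; rewrite IH // andbT /=.
by case: t Rt {tt IH} => //= _; case: k.
Qed.

Lemma rw_cat_nil t k : rw (t ++ nseq k [::]) = rw t.
Proof. by rewrite rw_cat rw_nil. Qed.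

Section Star.
Variables (n : nat) (lam mu : n.-tuple nat).
Hypotheses (hlam : sorted geq lam) (hmu : sorted geq mu).
Variables (T : tab lam) (U : tab mu).

Definition star_outer r :=
  if r < n then width lam + nth 0 mu r else nth 0 lam (r - n).

Lemma star_skew : skew_filling (star_inner lam) star_outer no_hole (star_filling T U).
Proof.
have lw r : nth 0 lam r <= width lam by exact: sorted_geq_nth.
rewrite /star_inner /star_outer /star_filling; split.
- move=> r c; case: ifP => rn; rewrite ?tab_fillingE andbT.
    by case: leqP => //= h; case: ifP => /=; lia.
  by case: ifP => /=; lia.
- by move=> r s rs; case: ifP => // sn; rewrite ifT //; lia.
- move=> r s rs; case: ifP => sn; case: ifP => rn //; try lia.
  + by rewrite leq_add2l sorted_geq_nth.
  + by apply: leq_trans (lw _) (leq_addr _ _).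
  + by apply: sorted_geq_nth => //; lia.
- by move=> r; case: ifP => // _; exact: leq_addr.
- move=> r c d x y; case: ifP => rn.
    case: leqP => // hc; case: leqP => // hd.
    move=> /tab_fillingP[z [zr zc ->]] /tab_fillingP[z' [zr' zc' ->]] cd.
    by apply: tab_row; [apply/val_inj; rewrite /= zr zr' | rewrite zc zc'; lia].
  move=> /tab_fillingP[z [zr zc ->]] /tab_fillingP[z' [zr' zc' ->]] cd.
  by apply: tab_row; [apply/val_inj; rewrite /= zr zr' | rewrite zc zc'].
- move=> r s c x y; have [rn|nr] := ltnP r n; have [sn|ns] := ltnP s n.
  + case: (leqP (width lam) c) => // hc.
    move=> /tab_fillingP[z [zr zc ->]] /tab_fillingP[z' [zr' zc' ->]] rs.
    by apply: tab_col; rewrite ?zr ?zr' ?zc ?zc'.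
  + case: (leqP (width lam) c) => // hc _; rewrite tab_fillingE; case: ifP => // h.
    by have := lw (s - n); lia.
  + by move=> _ _; lia.
  move=> /tab_fillingP[z [zr zc ->]] /tab_fillingP[z' [zr' zc' ->]] rs.
  by apply: tab_col; rewrite ?zr ?zr' ?zc ?zc' //; lia.
Qed.

Lemma star_frows : frows (star_filling T U) (n + n) (width lam + width mu) = rows U ++ rows T.
Proof.
apply: (@eq_from_nth _ [::]); first by rewrite size_cat !size_rows size_map size_iota.
move=> r; rewrite size_map size_iota => hr.
rewrite (nth_map 0) ?size_iota // nth_iota // add0n nth_cat size_rows /star_filling.
case: ifP => rn.
  rewrite iotaD pmap_cat add0n.
  have -> : pmap (fun c => if width lam <= c then tab_filling U r (c - width lam) else None)
      (iota 0 (width lam)) = [::].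
    have : {in iota 0 (width lam), forall c, c < width lam} by move=> c; rewrite mem_iota.
    elim: iota => //= c s IH h; rewrite leqNgt h ?mem_head //= IH // => d ds.
    by apply: h; rewrite inE ds orbT.
  rewrite cat0s -[X in iota X _]addn0 iotaDl.
  have -> s : pmap (fun c => if width lam <= c then tab_filling U r (c - width lam) else None)
      (map (addn (width lam)) s) = pmap (tab_filling U r) s.
    by elim: s => //= c s ->; rewrite leq_addr addKn.
  by rewrite pmap_tab_filling //; exact: sorted_geq_nth.
rewrite pmap_tab_filling //; apply: leq_trans (leq_addr _ _); exact: sorted_geq_nth.
Qed.

(** Whatever corners are chosen, the result is a straight tableau in the Knuth class of the row word
    of T * U, so [knuth_tableau_inj] leaves one possibility; [rectifies_exists] supplies a
    result. *)
Lemma star_rectification (nu : n.-tuple nat) (V : tab nu) : sorted geq nu ->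
  knuth (rw (rows T) ++ rw (rows U)) (rw (rows V)) ->
  @is_rectification n nu (star_inner lam) (star_filling T U) V.
Proof.
move=> hnu kV; set M := width lam + width mu.
have lM s : star_outer s <= M.
  rewrite /star_outer /M; case: ifP => _; first by rewrite leq_add2l; exact: sorted_geq_nth.
  by apply: leq_trans (leq_addr _ _); exact: sorted_geq_nth.
have lN s : n + n <= s -> star_outer s = 0.
  move=> ns; rewrite /star_outer ifN; last by lia.
  by rewrite nth_default // size_tuple; lia.
have all_eq F' : rectifies (star_inner lam) (star_filling T U) F' -> F' =2 tab_filling V.
  move=> rF; have [l' [sk ll kF]] := rectifies_knuth rF star_skew lM lN.
  have l'M s : l' s <= M := leq_trans (ll s) (lM s).
  (* The skew tableau occupies [n + n] rows, so [V] is padded with [n] empty ones. *)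
  have eF : frows F' (n + n) M = rows V ++ nseq n [::].
    apply: knuth_tableau_inj.
    - exact: tableau_frows sk l'M.
    - by apply: tableau_cat_nil; exact: tableau_rows.
    - by rewrite size_map size_iota size_cat size_rows size_nseq.
    rewrite rw_cat_nil; apply: knuth_trans (knuth_sym kF) _.
    by rewrite star_frows rw_cat.
  move=> r c; rewrite tab_fillingE; have [rn|nr] := ltnP r (n + n); last first.
    rewrite [nth 0 nu r]nth_default ?size_tuple; last by lia.
    have := sk_supp sk r c; have := ll r; rewrite lN //.
    by case: (F' r c) => //= x h; rewrite andbT => /esym; lia.
  have e : pmap (F' r) (iota 0 M) = nth [::] (rows V) r.
    have : nth [::] (frows F' (n + n) M) r = nth [::] (rows V) r.
      rewrite eF nth_cat; case: ltnP => // h; rewrite nth_nseq [RHS]nth_default //.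
      by case: ifP.
    by rewrite (nth_map 0) ?size_iota // nth_iota.
  have e' := @pmap_iota F' r M (iota 0 (l' r)) (iota_ltn_sorted _ _).
  rewrite -(size_nth_rows V) -e e' => [|d]; last first.
    by rewrite mem_iota (sk_supp sk) /=; have := l'M r; lia.
  rewrite size_map size_iota; have := sk_supp sk r c; rewrite andbT /=.
  case: ltnP => hc; last by case: (F' r c).
  rewrite (nth_map 0) ?size_iota // nth_iota // /fval add0n.
  by case: (F' r c).
split=> //; have [F' rF] := rectifies_exists star_skew lM lN.
by exists F' => //; exact: all_eq.
Qed.

End Star.

(** * Crystals of words *)

(** An embedding of a crystal into words that respects all of its structure. Components are studied
    through it alone, both for B_nu and for the tensor product. *)
Record reading n (B : crystal n) (W : B -> seq nat) : Prop := Reading {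
  rd_inj : injective W;
  rd_lt : forall x, all (gtn n) (W x);
  rd_wt : forall x (k : 'I_n), wt x k = Posz (count_mem (k : nat) (W x));
  rd_eps : forall i x, eps i x = Posz (weps i (W x));
  rd_phi : forall i x, phi i x = Posz (wphi i (W x));
  rd_e : forall i x, omap W (e_ i x) = we i (W x);
  rd_f : forall i x, omap W (f_ i x) = wf i (W x) }.

Lemma all_tword n (lam : n.-tuple nat) (hlam : sorted geq lam) (T : tab lam) :
  all (gtn n) (tword T).
Proof.
have /perm_all <- := sc_perm (knuth_same_crystal (knuth_rw_tword hlam T)).
by rewrite (perm_all _ (perm_rw _)); have /and3P[] := ntableau_rows hlam T.
Qed.

Lemma size_tword n (lam : n.-tuple nat) (hlam : sorted geq lam) (T : tab lam) :
  size (tword T) = sumn lam.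
Proof.
rewrite -(perm_size (sc_perm (knuth_same_crystal (knuth_rw_tword hlam T)))).
by rewrite (perm_size (perm_rw _)) size_flatten /shape shape_rows.
Qed.

Lemma reading_tab n (lam : n.-tuple nat) : sorted geq lam ->
  reading (B := tab_crystal lam) (@tword n lam).
Proof.
move=> hlam; split=> [||x k|i x|i x|i x|i x] /=.
- exact: tword_inj.
- exact: all_tword.
- rewrite ffunE /tword /colword count_columns ?iota_uniq //; congr Posz.
  by apply: eq_card => y; rewrite !inE mem_iota /= col_lt_width ?andbT.
- exact: tab_epsE.
- exact: tab_phiE.
- exact: tab_eE.
- exact: tab_fE.
Qed.

Definition tword2 n (lam mu : n.-tuple nat) (x : tab lam * tab mu) : seq nat :=
  tword x.1 ++ tword x.2.

Lemma maxz_subn (a b c : nat) :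
  Num.max (Posz b) (Posz a - Posz c + Posz b)%R = Posz (b + (a - c)).
Proof. by case: (Order.TotalTheory.leP (Posz b)) => h; move: h; lia. Qed.

Lemma reading_tensor n (lam mu : n.-tuple nat) : sorted geq lam -> sorted geq mu ->
  reading (B := tensor (tab_crystal lam) (tab_crystal mu)) (@tword2 n lam mu).
Proof.
move=> hlam hmu; have [_ _ rwt _ _ re rf] := reading_tab hlam.
have [_ _ rwt' _ _ re' rf'] := reading_tab hmu.
split=> [[x1 x2] [y1 y2]|x|x k|i x|i x|i x|i x]; rewrite /tword2 /=.
(* The shape fixes the length of the first factor's word, so the concatenation splits in one way. *)
- move=> e; have /eqP := e; rewrite eqseq_cat ?size_tword // => /andP[/eqP e1 /eqP e2].
  by rewrite (tword_inj hlam e1) (tword_inj hmu e2).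
- by rewrite all_cat !all_tword.
- by rewrite ffunE rwt rwt' count_cat PoszD.
- rewrite tab_epsE // tab_phiE // tab_epsE // weps_cat; exact: maxz_subn.
- rewrite tab_epsE // tab_phiE // tab_phiE // wphi_cat; exact: maxz_subn.
- rewrite tab_epsE // tab_phiE // we_cat ltz_nat.
  case: ifP => _; rewrite omap_omap.
    by rewrite -re /=; case: tab_e.
  by rewrite -re' /=; case: tab_e.
- rewrite tab_epsE // tab_phiE // wf_cat lez_nat.
  case: ifP => _; rewrite omap_omap.
    by rewrite -rf /=; case: tab_f.
  by rewrite -rf' /=; case: tab_f.
Qed.

Section Reading.
Variables (n : nat) (B : crystal n) (W : B -> seq nat).
Hypothesis rd : reading W.

Lemma rd_e_Some i x y : e_ i x = Some y -> we i (W x) = Some (W y).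
Proof. by move=> h; rewrite -(rd_e rd) h. Qed.

Lemma rd_we (i : 'I_n.-1) x w : we i (W x) = Some w -> exists2 y, e_ i x = Some y & W y = w.
Proof. by rewrite -(rd_e rd); case: (e_ i x) => // y [<-]; exists y. Qed.

Lemma rd_wf (i : 'I_n.-1) x w : wf i (W x) = Some w -> exists2 y, f_ i x = Some y & W y = w.
Proof. by rewrite -(rd_f rd); case: (f_ i x) => // y [<-]; exists y. Qed.

Lemma rd_we_index i x w : we i (W x) = Some w -> exists j : 'I_n.-1, i = j.
Proof.
move=> e; have [u [v [eW _]]] := we_SomeE e.
have := rd_lt rd x; rewrite eW all_cat /= => /andP[_ /andP[h _]].
by have hi : i < n.-1 by [lia]; exists (Ordinal hi).
Qed.

Lemma highest_weightP (x : B) : reflect (forall i, we i (W x) = None) (highest_weight x).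
Proof.
apply: (iffP forallP) => h i.
  case E: (we i (W x)) => [w|] //; have [j ij] := rd_we_index E; subst i.
  by have [y] := rd_we E; rewrite (eqP (h j)).
by have := h i; rewrite -(rd_e rd); case: (e_ i x).
Qed.

Lemma crystal_edge_sym : symmetric (@crystal_edge n B).
Proof. by move=> x y; apply: eq_existsb => i; rewrite orbC. Qed.

Lemma same_component_sym : connect_sym (@crystal_edge n B).
Proof. exact: sym_connect_sym crystal_edge_sym. Qed.

Lemma same_component_e i (x y : B) : e_ i x = Some y -> same_component x y.
Proof. by move=> h; apply: connect1; apply/existsP; exists i; rewrite h eqxx. Qed.

Lemma same_component_invariant (X : Type) (g : B -> X) :
  (forall i (x y : B), e_ i x = Some y -> g x = g y) ->
  forall x y : B, same_component x y -> g x = g y.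
Proof.
move=> h x y /connectP[p]; elim: p x => [|z p IH] x /=; first by move=> _ ->.
by move=> /andP[/existsP[i /orP[/eqP/h ->|/eqP/h <-]] pz] ey; exact: IH.
Qed.

Lemma exists_highest_weight (x : B) : exists2 b, same_component x b & highest_weight b.
Proof.
have [m] := ubnP (sumn (W x)); elim: m x => // m IH x ltm.
have [[i [w e]]|h] := we_dec (W x).
  have [j ij] := rd_we_index e; subst i.
  have [y exy Wy] := rd_we e; have [|b yb hb] := IH y.
    by have := sumn_we e; rewrite Wy; lia.
  by exists b => //; apply: connect_trans yb; exact: same_component_e exy.
by exists x; [exact: connect0 | apply/highest_weightP].
Qed.

End Reading.

(** * The shapes of the tableaux J^k *)

Lemma shape_we t t' i w w' : tableau t -> tableau t' -> size t = size t' ->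
  knuth (rw t) w -> knuth (rw t') w' -> we i w = Some w' -> map size t' = map size t.
Proof.
move=> tt tt' st k k' e; have [v ev kv] := knuth_we (knuth_sym k) e.
have [t'' [ev' tt'' st'' _]] := tableau_we tt ev; subst v.
rewrite -st''; congr (map size _); apply: knuth_tableau_inj => //.
  by rewrite -(size_map size t'') st'' size_map.
exact: knuth_trans k' kv.
Qed.

Section Shapes.
Variables (n : nat) (lam mu : n.-tuple nat).
Hypotheses (hlam : sorted geq lam) (hmu : sorted geq mu).
Implicit Types (T : tab lam) (U : tab mu).

(** Inserting from the last row up, each row from left to right, is the order of the row word. *)
Lemma JtabE T U k : Jtab T U k = foldl row_insert (rows T) (rw (drop k (rows U))).
Proof.
rewrite /Jtab; elim: (drop k _) => // R t IH.
by rewrite rw_cons foldl_cat /= IH.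
Qed.

Lemma ntableau_Jtab T U k : ntableau n (Jtab T U k).
Proof.
rewrite JtabE; apply: ntableau_insert_word; first exact: ntableau_rows.
rewrite (perm_all _ (perm_rw _)); have /and3P[_ _] := ntableau_rows hmu U.
by rewrite -{1}(cat_take_drop k (rows U)) flatten_cat all_cat => /andP[].
Qed.

Lemma knuth_Jtab T U k :
  knuth (rw (Jtab T U k)) (rw (rows T) ++ rw (drop k (rows U))).
Proof. by rewrite JtabE; apply: knuth_insert_word; exact: tableau_rows. Qed.

Lemma size_rw t : size (rw t) = sumn (map size t).
Proof. by rewrite (perm_size (perm_rw t)) size_flatten. Qed.

(* Both e_i applied to the row word of U and the row word of U' are row words  *)
(* of tableaux, in the Knuth class of e_i applied to the column word of U.     *)
Lemma we_rows i U U' : tab_e i U = Some U' -> we i (rw (rows U)) = Some (rw (rows U')).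
Proof.
move=> e; have eW : we i (tword U) = Some (tword U') by rewrite -tab_eE // e.
have [v ev kv] := knuth_we (knuth_sym (knuth_rw_tword hmu U)) eW.
have [t [et tt st _]] := tableau_we (tableau_rows hmu U) ev; subst v.
rewrite ev; congr (Some (rw _)); apply: knuth_tableau_inj => //.
- exact: tableau_rows.
- by rewrite -(size_map size t) st size_map !size_rows.
exact: knuth_trans (knuth_sym kv) (knuth_sym (knuth_rw_tword hmu U')).
Qed.

Lemma rw_take_drop k U : rw (rows U) = rw (drop k (rows U)) ++ rw (take k (rows U)).
Proof. by rewrite -{1}(cat_take_drop k (rows U)) rw_cat. Qed.
End Shapes.

Section ShapeInvariance.
Variables (n : nat) (lam mu : n.-tuple nat).
Hypotheses (hlam : sorted geq lam) (hmu : sorted geq mu).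
Notation B := (tensor (tab_crystal lam) (tab_crystal mu)).

(** J^k is the insertion tableau of a prefix of the word. The prefix is either changed by e_i, which
    preserves the insertion shape ([shape_we]), or not changed at all. *)
Lemma Jshape_e i (x y : B) : e_ i x = Some y ->
  forall k, Jshape x.1 x.2 k = Jshape y.1 y.2 k.
Proof.
case: x y => [T U] [T' U'] /= e k; symmetry.
have kT := knuth_same_crystal (knuth_rw_tword hlam T).
have kU := knuth_same_crystal (knuth_rw_tword hmu U).
have szJ : size (Jtab T U k) = size (Jtab T' U' k).
  have /and3P[_ /eqP -> _] := ntableau_Jtab hlam hmu T U k.
  by have /and3P[_ /eqP -> _] := ntableau_Jtab hlam hmu T' U' k.
have /and3P[tJ _ _] := ntableau_Jtab hlam hmu T U k.
have /and3P[tJ' _ _] := ntableau_Jtab hlam hmu T' U' k.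
suff [[i' h]|h] : (exists i', we i' (rw (rows T) ++ rw (drop k (rows U))) =
          Some (rw (rows T') ++ rw (drop k (rows U')))) \/
        rw (rows T) ++ rw (drop k (rows U)) = rw (rows T') ++ rw (drop k (rows U')).
- exact: (shape_we tJ tJ' szJ (knuth_Jtab hlam T U k) (knuth_Jtab hlam T' U' k) h).
- congr (map size _); apply: knuth_tableau_inj => //.
  apply: knuth_trans (knuth_Jtab hlam T' U' k) _; rewrite -h.
  exact: knuth_sym (knuth_Jtab hlam T U k).
move: e; rewrite tab_epsE // tab_phiE // ltz_nat -(sc_eps kT) -(sc_phi kU).
rewrite (rw_take_drop k U) wphi_cat; case: ltnP => h.
  (* The inserted rows have [wphi] at most that of all of [U], so e_i acts on [T] in the prefix as
     well. *)
  case E: (tab_e i T) => [T1|] //= [<- <-]; left; exists i.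
  by rewrite we_cat (we_rows hlam E) ifT //=; lia.
case E: (tab_e i U) => [U1|] //= [<- <-].
have := we_rows hmu E; rewrite (rw_take_drop k U) (rw_take_drop k U1) we_cat.
have sz : size (rw (drop k (rows U))) = size (rw (drop k (rows U1))).
  by rewrite !size_rw !map_drop !shape_rows.
case: ltnP => h'.
  (* Here the inserted rows have the same [wphi] as all of [U], so e_i acts on them in the prefix as
     well. *)
  case E': (we i (rw (drop k (rows U)))) => [v|] //= [] /eqP.
  rewrite eqseq_cat ?(size_we E') // => /andP[/eqP ev _]; left; exists i.
  by rewrite we_cat E' ifN /= ?ev // -leqNgt; lia.
(* The change falls in the first [k] rows of [U], outside the prefix. *)
case E': (we i _) => [v|] //= [] /eqP.
by rewrite eqseq_cat // => /andP[/eqP -> _]; right.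
Qed.

Lemma Jshape_component (x y : B) : same_component x y ->
  forall k, Jshape x.1 x.2 k = Jshape y.1 y.2 k.
Proof.
move=> h k; move: x y h.
by apply: same_component_invariant => i x y e; exact: Jshape_e e k.
Qed.

Lemma Rarray_component (x y : B) i j : same_component x y ->
  Rarray x.1 x.2 i j = Rarray y.1 y.2 i j.
Proof. by move=> h; rewrite /Rarray !(Jshape_component h). Qed.

End ShapeInvariance.

(** * The array R at a highest weight element *)

(** Each copy of [a] lands right after the previous one and bumps the first remaining letter of [C];
    once [C] is exhausted, copies are appended. *)
Lemma insert_nseq_row A C t m a : all (geq a) A -> all (ltn a) C ->
  foldl row_insert ((A ++ C) :: t) (nseq m a) =
  (A ++ nseq m a ++ drop m C) :: foldl row_insert t (take m C).
Proof.
elim: m A C t => [|m IH] A C t Aa Ca; first by rewrite take0 drop0.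
rewrite [foldl _ _ _]/=; have Aa' : all (geq a) (rcons A a) by rewrite all_rcons /= leqnn.
have fA : has (ltn a) A = false.
  by apply/hasPn => x /(allP Aa) /=; rewrite -leqNgt.
case: C Ca => [|c C] /= => [_|/andP[ac Ca]].
  rewrite cats0 ifN; last by rewrite -has_find fA.
  by have := IH (rcons A a) [::] t Aa' isT; rewrite cats0 => ->; rewrite -cats1 -catA; case: m {IH}.
rewrite find_cat fA /= ac addn0 size_cat /= -[X in X < _]addn0 ltn_add2l /=.
rewrite nth_cat ltnn subnn /= set_nthE size_cat /= -[X in X < _]addn0 ltn_add2l /=.
rewrite take_size_cat // -cat_rcons drop_cat ltnNge leqnSn /= subSnn /= drop0.
by rewrite IH // cat_rcons.
Qed.

Lemma last_row_insert t w x : x \in head [::] (foldl row_insert t (rcons w x)).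
Proof.
rewrite foldl_rcons head_row_insert; set R := head _ _.
by apply/(nthP 0); exists (find (ltn x) R); rewrite ?size_set_nth ?nth_set_nth /= ?eqxx // leq_max leqnn.
Qed.

Lemma sumn_insert t w : tableau t ->
  sumn (map size (foldl row_insert t w)) = sumn (map size t) + size w.
Proof.
move=> tt; rewrite -!size_rw (perm_size (sc_perm (knuth_same_crystal (knuth_insert_word w tt)))).
by rewrite size_cat.
Qed.

Lemma sorted_split_leq a R : sorted leq R ->
  exists A C, [/\ R = A ++ C, all (geq a) A & all (ltn a) C].
Proof.
elim: R => [|x R IH] sR; first by exists [::], [::].
have [xa|ax] := leqP x a.
  have [A [C [-> hA hC]]] := IH (path_sorted sR).
  by exists (x :: A), C; split=> //=; rewrite xa.
exists [::], (x :: R); split=> //=; rewrite ax /=.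
by apply: sub_all (order_path_min leq_trans sR) => y; exact: leq_trans.
Qed.

(* The letters bumped from row j are exactly its letters a + j + 1: the letters *)
(* above a + j must leave row j, and those that settle in row j + 1 are at most *)
(* a + j + 1.                                                                  *)
Lemma insert_nseq t m a : tableau t ->
  (forall j, all (geq (a + j)) (nth [::] (foldl row_insert t (nseq m a)) j)) ->
  [/\ forall j, all (geq (a + j).+1) (nth [::] t j),
      forall j, sumn (drop j.+1 (map size (foldl row_insert t (nseq m a)))) =
        sumn (drop j.+1 (map size t)) + count_mem (a + j).+1 (nth [::] t j) &
      forall j b, b <= a + j ->
        count (gtn b) (nth [::] (foldl row_insert t (nseq m a)) j) =
        count (gtn b) (nth [::] t j)].
Proof.
have cn b k c : b <= c -> count (gtn b) (nseq k c) = 0.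
  by move=> bc; rewrite count_nseq /= ltnNge bc.
elim: t m a => [|R t IH] m a.
  move=> _ _; have -> : foldl row_insert [::] (nseq m a) = if m is 0 then [::] else [:: nseq m a].
    case: m => //= m; have := @insert_nseq_row [:: a] [::] [::] m a; rewrite /= leqnn.
    by move=> -> //; rewrite cats0.
  case: m => [|m]; split=> [j|j|j b]; rewrite ?nth_nil //.
  by case: j => [|j] h; [rewrite addn0 in h; exact: (cn _ m.+1) | rewrite /= nth_nil].
rewrite tableau_cons => /and3P[sR Rt tt].
have [A [C [eR Aa Ca]]] := sorted_split_leq a sR.
have sC : sorted leq C by move: sR; rewrite eR => /cat_sorted2[].
rewrite eR insert_nseq_row // => h.
have C0 : drop m C = [::].
  have := h 0; rewrite /= addn0 !all_cat => /and3P[_ _].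
  have := Ca; rewrite -{1}(cat_take_drop m C) all_cat => /andP[_].
  by case: (drop m C) => //= x s /andP[ax _] /andP[xa _]; lia.
have eC : take m C = C by rewrite -[RHS](cat_take_drop m C) C0 cats0.
rewrite C0 eC cats0 in h *.
(* The largest letter of [C] is inserted last below, so it stays in row 1, whose final letters are
   at most [a + 1]; all of [C] exceeds [a]. *)
have nC : C = nseq (size C) a.+1.
  apply/all_pred1P/allP => x xC /=; have ax : a < x := allP Ca _ xC.
  rewrite eqn_leq ax andbT.
  move: xC (h 1) sC; case/lastP: C {Ca eR C0 eC h} => // C z xC /= h sC.
  have := h; have := last_row_insert t C z.
  rewrite -nth0 => hz /allP/(_ _ hz) /=; rewrite addn1; apply: leq_trans.
  move: sC xC; rewrite sorted_rcons_leq mem_rcons inE => /andP[_ /allP sC].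
  by case/orP=> [/eqP -> //|/sC].
have [h1 h2 h3] : [/\ forall j, all (geq (a.+1 + j).+1) (nth [::] t j),
      forall j, sumn (drop j.+1 (map size (foldl row_insert t C))) =
        sumn (drop j.+1 (map size t)) + count_mem (a.+1 + j).+1 (nth [::] t j) &
      forall j b, b <= a.+1 + j ->
        count (gtn b) (nth [::] (foldl row_insert t C) j) =
        count (gtn b) (nth [::] t j)].
  rewrite nC; apply: IH => // j; rewrite -nC.
  by have := h j.+1; rewrite /= addSnnS.
split=> [[|j]|[|j]|[|j] b bj] /=.
- rewrite addn0 all_cat nC all_nseq /= leqnn orbT andbT.
  by apply: sub_all Aa => x /=; lia.
- by rewrite -addSnnS; exact: h1.
- rewrite !drop0 sumn_insert // addn0 count_cat (count_memPn _) ?add0n; last first.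
    by apply/negP => /(allP Aa) /=; rewrite ltnn.
  by congr (_ + _); rewrite [in RHS]nC count_nseq /= eqxx mul1n.
- by rewrite -addSnnS; exact: h2.
- rewrite addn0 in bj; rewrite !count_cat cn // addn0 nC cn ?addn0 //; exact: leqW.
- by apply: h3; rewrite addSnnS.
Qed.

Lemma nth_hw_rows n (mu : n.-tuple nat) r : nth [::] (rows (hw_tab mu)) r = nseq (nth 0 mu r) r.
Proof.
have [rn|nr] := ltnP r n; last first.
  by rewrite !nth_default ?size_rows // size_tuple.
rewrite -[r]/(nat_of_ord (Ordinal rn)) nth_rows.
apply: (@eq_from_nth _ 0); first by rewrite size_trow size_nseq (tnth_nth 0).
move=> c; rewrite size_trow => hc.
rewrite -[c]/(nat_of_ord (Ordinal hc)) nth_trow nth_nseq ffunE /=.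
by move: hc; rewrite (tnth_nth 0) /= => ->.
Qed.

Lemma hw_tabE n (nu : n.-tuple nat) (hnu : sorted geq nu) (V : tab nu) :
  (forall i, weps i (rw (rows V)) = 0) -> V = hw_tab nu.
Proof.
move=> h; apply: rows_inj; apply: (@eq_from_nth _ [::]); first by rewrite !size_rows.
move=> r; rewrite size_rows => rn; rewrite nth_hw_rows.
have := @hw_rows 0 _ (tableau_rows hnu V) _ (fun i _ => h i) r.
rewrite add0n => -> //; last exact/allP.
congr nseq; rewrite -(shape_rows V) (nth_map [::]) // size_rows //.
Qed.

Section RarrayHighest.
Variables (n : nat) (lam mu : n.-tuple nat).
Hypotheses (hlam : sorted geq lam) (hmu : sorted geq mu).
Variable R : tab lam.
Let H := hw_tab mu.
Hypothesis hw : forall i, weps i (rw (rows R) ++ rw (rows H)) = 0.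

Lemma Jtab_step k : k < n ->
  Jtab R H k = foldl row_insert (Jtab R H k.+1) (nseq (nth 0 mu k) k).
Proof.
move=> kn; rewrite !JtabE (drop_nth [::]) ?size_rows // rw_cons foldl_cat.
by rewrite nth_hw_rows.
Qed.

Lemma tableau_Jtab k : tableau (Jtab R H k).
Proof. by have /and3P[] := ntableau_Jtab hlam hmu R H k. Qed.

(** J^0 has a highest weight word, so its row [j] consists of letters [j]. Undoing one insertion,
    from J^k to J^(k+1), raises the bound by one ([insert_nseq]). *)
Lemma Jtab_rows k : k <= n -> forall j, all (geq (k + j)) (nth [::] (Jtab R H k) j).
Proof.
elim: k => [_ j|k IH kn j].
  have k0 := knuth_same_crystal (knuth_Jtab hlam R H 0); rewrite drop0 in k0.
  rewrite (@hw_rows 0 _ (tableau_Jtab 0)); last first.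
  - by move=> i _; rewrite (sc_eps k0).
  - exact/allP.
  by rewrite all_nseq /= leqnn orbT.
have := IH (ltnW kn); rewrite Jtab_step // => h.
by have [h1 _ _] := insert_nseq (tableau_Jtab k.+1) h; exact: h1.
Qed.

(** From J^n, which is [R], to J^(k+1) only rows of index at least [k + 1] are inserted, and by the
    last clause of [insert_nseq] these do not change the number of letters up to [k + j] in row
    [j]. *)
Lemma Jtab_letters k j : k < n ->
  count (gtn (k + j).+1) (nth [::] (Jtab R H k.+1) j) =
  count (gtn (k + j).+1) (nth [::] (rows R) j).
Proof.
move=> kn; have Jn : Jtab R H n = rows R.
  by rewrite JtabE drop_oversize // size_rows.
suff h d : k.+1 + d <= n -> count (gtn (k + j).+1) (nth [::] (Jtab R H (k.+1 + d)) j) =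
    count (gtn (k + j).+1) (nth [::] (Jtab R H k.+1) j).
  by rewrite -(h (n - k.+1)) subnKC // Jn.
elim: d => [|d IH] hd; first by rewrite addn0.
have hd' : k.+1 + d < n by lia.
rewrite -IH ?(ltnW hd') // (Jtab_step hd') addnS.
have := Jtab_rows (ltnW hd'); rewrite Jtab_step // => h.
have [_ _ h3] := insert_nseq (tableau_Jtab (k.+1 + d).+1) h.
by rewrite h3 //; lia.
Qed.

(** With [k = i - j], inserting row [k] of [H] into J^(k+1) adds to the rows below [j.-1] as many
    cells as row [j.-1] has letters [i]. The difference defining the array is thus the length of
    that row minus its letters [i]. No letter there exceeds [i], and the letters below [i] are as
    many as in [R]. *)
Lemma Rarray_hw i j : 1 <= j <= i -> i <= n ->
  Rarray R H i j = Posz (count (gtn i) (nth [::] (rows R) j.-1)).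
Proof.
case: j => [|j] //= ji ni; rewrite /Rarray /Jshape /=.
have kn : i - j.+1 < n by lia.
set k := i - j.+1 in kn *; have ei : i = (k + j).+1 by lia.
have := Jtab_rows (ltnW kn); rewrite (Jtab_step kn) => h.
have [h1 h2 _] := insert_nseq (tableau_Jtab k.+1) h.
rewrite h2 ei -Jtab_letters //.
set J := Jtab R H k.+1 in h1 *.
have -> : sumn (drop j (map size J)) = size (nth [::] J j) + sumn (drop j.+1 (map size J)).
  have [jJ|Jj] := ltnP j (size J).
    by rewrite (drop_nth 0) ?size_map //= (nth_map [::]).
  by rewrite !drop_oversize ?size_map ?nth_default // leqW.
have -> : size (nth [::] J j) = count (gtn (k + j).+1) (nth [::] J j) +
    count_mem (k + j).+1 (nth [::] J j).
  rewrite -(count_predC (gtn (k + j).+1)); congr (_ + _).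
  apply: eq_in_count => x /(allP (h1 j)) /=; lia.
lia.
Qed.

End RarrayHighest.

(** * Gelfand-Tsetlin patterns of tableaux *)

Lemma gtE n (lam : n.-tuple nat) (V : tab lam) i j : 0 < j ->
  gt V i j = Posz (count (gtn i) (nth [::] (rows V) j.-1)).
Proof.
case: j => // j _ /=; rewrite /gt; congr Posz.
have [jn|nj] := ltnP j n; last first.
  rewrite nth_default ?size_rows //; apply: eq_card0 => x; rewrite inE eqSS.
  by apply/negP => /andP[_ /eqP xj]; have := ltn_ord (row_of x); rewrite xj ltnNge nj.
rewrite -[j]/(nat_of_ord (Ordinal jn)); move: (Ordinal jn) => r; rewrite nth_rows.
transitivity #|[set mkcell c | c : 'I_(tnth lam r) in [set c | val V (mkcell c) < i]]|.
  apply: eq_card => x; rewrite !inE eqSS val_eqE; apply/andP/imsetP => [[xi /eqP xr]|[c]].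
    case: x xi xr => s c /= xi; rewrite /row_of /= => sr; subst s.
    by exists c; rewrite ?inE.
  by rewrite inE => ci ->; rewrite /row_of /=.
rewrite card_imset; last by move=> c d /(congr1 (@col_of n lam)) /val_inj.
rewrite cardsE -sum1_card count_map -sum1_count [RHS]big_enum_cond.
exact: eq_bigl.
Qed.

Lemma sorted_count R c i : sorted leq R -> c < size R ->
  (nth 0 R c < i) = (c < count (gtn i) R).
Proof.
elim: R c => // x R IH c sR; have [xi|ix] := ltnP x i.
  case: c => [|c] hc /=; rewrite xi // add1n ltnS; exact: IH (path_sorted sR) hc.
have c0 : count (gtn i) (x :: R) = 0.
  apply/eqP; rewrite -leqn0 leqNgt -has_count; apply/hasPn => y.
  rewrite inE /= -leqNgt => /orP[/eqP->//|/(allP (order_path_min leq_trans sR))].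
  exact: leq_trans.
rewrite c0 => hc; apply/negbTE; rewrite -leqNgt; apply: leq_trans ix _.
apply: (sorted_leq_nth leq_trans leqnn 0 (s := x :: R) sR 0 c) => //; by rewrite inE.
Qed.

(** Above each letter of [S] that is at most [i] stands a letter of [R] less than [i]; this gives
    the interlacing inequality. *)
Lemma count_above R S i : above R S -> count (gtn i.+1) S <= count (gtn i) R.
Proof.
move=> /aboveP[h1 h2].
have e s k : count (gtn k) s = count (fun c => nth 0 s c < k) (iota 0 (size s)).
  by rewrite -[in LHS](mkseq_nth 0 s) count_map.
rewrite !e -(subnKC h1) iotaD count_cat; apply: leq_trans (leq_addr _ _).
by apply: leq_count_in => c; rewrite mem_iota => /h2 h; rewrite ltnS; exact: leq_trans.
Qed.

Section GTpatterns.
Variables (n : nat) (lam : n.-tuple nat).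
Hypothesis hlam : sorted geq lam.

Lemma gt_pattern_gt (V : tab lam) : gt_pattern lam (gt V).
Proof.
split=> [r|i j /andP[j0 ji] ni].
  rewrite gtE //= nth_rows -(size_trow V r); congr Posz; apply/eqP.
  by rewrite -all_count; apply/allP => x /mapP[c _ ->] /=.
rewrite !gtE // !lez_nat; split; last by apply: sub_count => x /=; exact: ltnW.
case: j j0 ji => // j _ ji /=; apply: count_above.
have /andP[_ /(sortedP [::]) h] := tableau_rows hlam V; apply: h.
by rewrite size_rows; lia.
Qed.

Lemma gt_inj (V V' : tab lam) :
  (forall i j, 1 <= j <= i -> i <= n -> gt V i j = gt V' i j) -> V = V'.
Proof.
have wlog_le (X Y : tab lam) : (forall i j, 1 <= j <= i -> i <= n -> gt X i j = gt Y i j) ->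
    forall x, val Y x <= val X x.
  move=> h [r c]; rewrite leqNgt; apply/negP => lt.
  have {}lt : (val X (mkcell c) : nat) < val Y (mkcell c) := lt.
  (* Row [r] has letters at least [r], so the indices compared lie in the triangle [1 <= j <= i]. *)
  have hr : r <= val X (mkcell c).
    rewrite -(nth_trow X c) -[r in r <= _]add0n.
    apply: (@all_ltn_index 0 (rows X)); [exact: tableau_rows | exact/allP |].
    by rewrite nth_rows; apply: mem_nth; rewrite size_trow.
  have := h (val Y (mkcell c)) r.+1; rewrite !gtE //= !nth_rows.
  move=> /(_ (leq_ltn_trans hr lt) (ltnW (ltn_ord _))) [e].
  have srt (Z : tab lam) : sorted leq (trow Z r).
    have /andP[/allP hs _] := tableau_rows hlam Z; apply: hs.
    by rewrite -nth_rows mem_nth // size_rows.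
  have sc (Z : tab lam) : c < size (trow Z r) by rewrite size_trow.
  move: lt; rewrite -(nth_trow X c) (sorted_count _ (srt X) (sc X)) e.
  by rewrite -(sorted_count _ (srt Y) (sc Y)) nth_trow ltnn.
move=> h; apply/val_inj/ffunP => x; apply/val_inj/eqP.
by rewrite eqn_leq !wlog_le // => i j ji ni; rewrite h.
Qed.

End GTpatterns.

(** * The component of a highest weight element *)

Lemma above_trans : transitive above.
Proof.
move=> S R Q /aboveP[h1 h2] /aboveP[h3 h4]; apply/aboveP; split; first exact: leq_trans h1.
by move=> j hj; apply: ltn_trans (h2 j (leq_trans hj h3)) (h4 j hj).
Qed.

Lemma tab_of_rows n t : ntableau n t ->
  exists (nu : n.-tuple nat) (V : tab nu),
    [/\ sorted geq nu, nu = map size t :> seq nat & rows V = t].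
Proof.
move=> /and3P[tt /eqP st tn]; have /andP[st1 st2] := tt.
have sz : size (map size t) == n by rewrite size_map st.
pose nu : n.-tuple nat := Tuple sz; exists nu.
have hnu : sorted geq nu.
  by rewrite sorted_map; apply: sub_sorted st2 => R S /aboveP[].
have tnu (r : 'I_n) : tnth nu r = size (nth [::] t r).
  by rewrite (tnth_nth 0) /= (nth_map [::]) // st.
pose v (x : cell nu) := nth 0 (nth [::] t (row_of x)) (col_of x).
have cx (x : cell nu) : col_of x < size (nth [::] t (row_of x)).
  by rewrite -tnu; exact: ltn_ord.
have vn x : v x < n.
  apply: (allP tn); apply/flattenP; exists (nth [::] t (row_of x)); apply: mem_nth => //.
  by rewrite st.
have ss : semistandard [ffun x => Ordinal (vn x)].
  apply/forallP => x; apply/forallP => y; rewrite !ffunE /=.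
  apply/andP; split; apply/implyP => /andP[].
    move=> /eqP rxy cxy; rewrite /v rxy.
    have sR : sorted leq (nth [::] t (row_of y)).
      by apply: (allP st1); apply: mem_nth; rewrite st.
    apply: (sorted_leq_nth leq_trans leqnn 0 sR) => //; rewrite inE ?cx //.
    by rewrite -rxy cx.
  move=> rxy /eqP cxy; rewrite /v cxy.
  have /aboveP[_ h] : above (nth [::] t (row_of x)) (nth [::] t (row_of y)).
    by apply: (sorted_ltn_nth above_trans [::] st2) => //; rewrite inE st.
  by apply: h; rewrite cx.
exists (exist (fun t => semistandard t) _ ss); split=> //.
apply: (@eq_from_nth _ [::]); first by rewrite size_rows st.
move=> r; rewrite size_rows => rn; rewrite -[r]/(nat_of_ord (Ordinal rn)) nth_rows.
apply: (@eq_from_nth _ 0); first by rewrite size_trow tnu.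
move=> c; rewrite size_trow => hc; rewrite -[c]/(nat_of_ord (Ordinal hc)) nth_trow.
by rewrite /= ffunE.
Qed.

(** The insertion tableau P(w), padded to [n] rows. *)
Definition ptab n w := foldl row_insert (nseq n [::]) w.

Lemma ntableau_ptab n w : all (gtn n) w -> ntableau n (ptab n w).
Proof. exact: ntableau_insert_word (ntableau_nil n). Qed.

Lemma knuth_ptab n w : knuth (rw (ptab n w)) w.
Proof.
have /and3P[h _ _] := ntableau_nil n.
by have := knuth_insert_word w h; rewrite rw_nil.
Qed.

Lemma ptab_eq n w t : all (gtn n) w -> ntableau n t -> knuth w (rw t) -> ptab n w = t.
Proof.
move=> /ntableau_ptab/and3P[h1 /eqP h2 _] /and3P[h3 /eqP h4 _] k.
by apply: knuth_tableau_inj => //; [rewrite h2 h4 | apply: knuth_trans (knuth_ptab n w) k].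
Qed.

Section Component.
Variables (n : nat) (B : crystal n) (W : B -> seq nat).
Hypothesis rd : reading W.

Lemma shape_component x y : same_component x y ->
  map size (ptab n (W x)) = map size (ptab n (W y)).
Proof.
move: x y; apply: same_component_invariant => i x y e.
have /and3P[h1 /eqP h2 _] := ntableau_ptab (rd_lt rd x).
have /and3P[h3 /eqP h4 _] := ntableau_ptab (rd_lt rd y).
symmetry; apply: (shape_we h1 h3 _ (knuth_ptab _ _) (knuth_ptab _ _) (rd_e_Some rd e)).
by rewrite h2 h4.
Qed.

Variables (nu : n.-tuple nat) (b : B).
Hypothesis hnu : sorted geq nu.
Hypothesis shape_b : map size (ptab n (W b)) = nu.
Hypothesis hb : highest_weight b.
Hypothesis hb_uniq : forall x, same_component b x -> highest_weight x -> x = b.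

Let rdV := reading_tab hnu.

Lemma component_tab x : same_component b x ->
  exists V : tab nu, rows V = ptab n (W x).
Proof.
move=> bx; have [nu' [V [h1 h2 h3]]] := tab_of_rows (ntableau_ptab (rd_lt rd x)).
have e : nu' = nu by apply/val_inj; rewrite /= h2 -(shape_component bx) shape_b.
by subst nu'; exists V.
Qed.

Lemma knuth_highest : knuth (tword (hw_tab nu)) (W b).
Proof.
have [V eV] := component_tab (connect0 _ b).
have kV : knuth (rw (rows V)) (W b) by rewrite eV; exact: knuth_ptab.
have -> : hw_tab nu = V.
  apply/esym/hw_tabE => // i; rewrite (sc_eps (knuth_same_crystal kV)); apply/eqP.
  by rewrite -we_None; have /(highest_weightP rd)/(_ i) -> := hb.
exact: knuth_trans (knuth_sym (knuth_rw_tword hnu V)) kV.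
Qed.

(** Both elements descend in step to highest weight elements, which can only be [b]; inverting the
    e_i leads back to equal words. *)
Lemma knuth_component_inj x y : same_component b x -> same_component b y ->
  knuth (W x) (W y) -> x = y.
Proof.
have [m] := ubnP (sumn (W x)); elim: m x y => // m IH x y ltm bx by_ k.
have [[i [w e]]|h] := we_dec (W x).
  have [j ij] := rd_we_index rd e; subst i.
  have [x1 ex Wx] := rd_we rd e; have [w' e' k'] := knuth_we k e.
  have [y1 ey Wy] := rd_we rd e'; subst w w'.
  have xy1 : x1 = y1.
    apply: IH k'; first by have := sumn_we e; lia.
      exact: connect_trans bx (same_component_e ex).
    exact: connect_trans by_ (same_component_e ey).
  subst y1; apply: (rd_inj rd); have [_ _ f] := we_step e; have [_ _ f'] := we_step e'.
  by move: f'; rewrite f => -[].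
rewrite (hb_uniq bx); last exact/(highest_weightP rd).
rewrite (hb_uniq by_) //; apply/(highest_weightP rd) => i.
by have := sc_e (knuth_same_crystal k) i; rewrite h; case: (we i (W y)).
Qed.

Lemma highest_tab (V : tab nu) : (forall i, we i (tword V) = None) -> V = hw_tab nu.
Proof.
move=> h; apply: hw_tabE => // i; apply/eqP.
by rewrite (sc_eps (knuth_same_crystal (knuth_rw_tword hnu V))) -we_None h.
Qed.

(** Descend from [V] to [hw_tab nu], whose word is Knuth equivalent to that of [b], and retrace the
    path from [b] by the f_i. The conclusion is boolean for the sake of [xchoose]. *)
Lemma component_lift (V : tab nu) :
  exists x, same_component b x && (ptab n (W x) == rows V).
Proof.
suff [x bx k] : exists2 x, same_component b x & knuth (W x) (tword V).
  exists x; rewrite bx; apply/eqP/ptab_eq; [exact: rd_lt | exact: ntableau_rows |].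
  exact: knuth_trans k (knuth_sym (knuth_rw_tword hnu V)).
have [m] := ubnP (sumn (tword V)); elim: m V => // m IH V ltm.
have [[i [w e]]|h] := we_dec (tword V); last first.
  by exists b; [exact: connect0 | rewrite (highest_tab h); exact: knuth_sym knuth_highest].
have [j ij] := rd_we_index rdV e; subst i; have [V1 eV WV] := rd_we rdV e; subst w.
have [|x1 bx1 k1] := IH V1; first by have := sumn_we e; lia.
have [_ _ f] := we_step e; have [w f' k] := knuth_wf (knuth_sym k1) f.
have [x fx Wx] := rd_wf rd f'; subst w; exists x; last exact: knuth_sym.
apply: connect_trans bx1 _; rewrite same_component_sym; apply: (same_component_e (i := j)).
have := wf_step f'; rewrite -(rd_e rd); case: (e_ j x) => // y [/(rd_inj rd) ->] //.
Qed.

(** The inverse of the map that sends an element of the component of [b] to the insertion tableau of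
    its word. *)
Definition lift_component : {ffun tab_crystal nu -> B} :=
  [ffun V => xchoose (component_lift V)].

Lemma lift_componentP (V : tab nu) :
  same_component b (lift_component V) /\ knuth (W (lift_component V)) (tword V).
Proof.
rewrite ffunE; move: (xchooseP (component_lift V)); set x := xchoose _.
move=> /andP[-> /eqP e]; split=> //.
apply: knuth_trans (knuth_rw_tword hnu V); rewrite -e.
exact: knuth_sym (knuth_ptab _ _).
Qed.

Lemma lift_componentE (V : tab nu) x : same_component b x -> knuth (W x) (tword V) ->
  lift_component V = x.
Proof.
move=> bx k; have [bV kV] := lift_componentP V; apply: knuth_component_inj => //.
exact: knuth_trans kV (knuth_sym k).
Qed.

Lemma knuth_tword_inj (V V' : tab nu) : knuth (tword V) (tword V') -> V = V'.
Proof.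
move=> k; apply: rows_inj; apply: knuth_tableau_inj; rewrite ?size_rows //; try exact: tableau_rows.
apply: knuth_trans (knuth_rw_tword hnu V) _.
exact: knuth_trans k (knuth_sym (knuth_rw_tword hnu V')).
Qed.

Lemma lift_component_hw : lift_component (hw_tab nu) = b.
Proof. by apply: lift_componentE; [exact: connect0 | exact: knuth_sym knuth_highest]. Qed.

Lemma lift_component_iso : iso_onto_component b lift_component.
Proof.
apply/and5P; split.
- apply/injectiveP => V V' e; apply: knuth_tword_inj.
  have [_ k] := lift_componentP V; have [_ k'] := lift_componentP V'.
  by rewrite e in k; exact: knuth_trans (knuth_sym k) k'.
- apply/forallP => y; apply/eqP; apply/idP/idP => [/codomP[V ->]|bby].
    by have [] := lift_componentP V.
  have [V eV] := component_tab bby; apply/codomP; exists V.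
  apply/esym/lift_componentE => //.
  apply: knuth_trans (knuth_rw_tword hnu V); rewrite eV.
  exact: knuth_sym (knuth_ptab _ _).
- apply/forallP => V; apply/eqP/ffunP => k; rewrite (rd_wt rd) (rd_wt rdV).
  have [_ kV] := lift_componentP V.
  by rewrite (permP (sc_perm (knuth_same_crystal kV))).
- apply/forallP => i; apply/forallP => V; have [_ kV] := lift_componentP V.
  rewrite !(rd_eps rd) !(rd_phi rd) (rd_eps rdV) (rd_phi rdV).
  by rewrite (sc_eps (knuth_same_crystal kV)) (sc_phi (knuth_same_crystal kV)) !eqxx.
apply/forallP => i; apply/forallP => V; have [bV kV] := lift_componentP V.
apply/andP; split; apply/eqP.
  have := sc_e (knuth_same_crystal kV) i; rewrite -(rd_e rd) -(rd_e rdV).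
  case E: (e_ i (lift_component V)) => [x|]; case: (e_ i V) => [V1|] //= k1.
  congr Some; apply/esym/lift_componentE => //.
  exact: connect_trans bV (same_component_e E).
have := sc_f (knuth_same_crystal kV) i; rewrite -(rd_f rd) -(rd_f rdV).
case E: (f_ i (lift_component V)) => [x|]; case: (f_ i V) => [V1|] //= k1.
congr Some; apply/esym/lift_componentE => //.
have f : wf i (W (lift_component V)) = Some (W x) by rewrite -(rd_f rd) E.
apply: connect_trans bV _; rewrite same_component_sym; apply: (same_component_e (i := i)).
by have := wf_step f; rewrite -(rd_e rd); case: (e_ i x) => // y [/(rd_inj rd) ->].
Qed.

(** Since [bracket] picks an arbitrary isomorphism, its values must be pinned down: [V] and its
    image descend in parallel to [hw_tab nu] and [b], whose words are Knuth equivalent. *)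
Lemma iso_knuth (psi : {ffun tab_crystal nu -> B}) (V : tab nu) :
  iso_onto_component b psi -> psi (hw_tab nu) = b -> knuth (W (psi V)) (tword V).
Proof.
move=> /and5P[_ _ _ _ /forallP ef] hw.
have [m] := ubnP (sumn (tword V)); elim: m V => // m IH V ltm.
have [[i [w e]]|h] := we_dec (tword V); last first.
  by rewrite (highest_tab h) hw; exact: knuth_sym knuth_highest.
have [j ij] := rd_we_index rdV e; subst i; have [V1 eV WV] := rd_we rdV e; subst w.
have /forallP/(_ V)/andP[/eqP epsi _] := ef j; rewrite eV /= in epsi.
have k1 : knuth (W (psi V1)) (tword V1) by apply: IH; have := sumn_we e; lia.
have [_ _ f] := we_step e; have [_ _ f'] := we_step (rd_e_Some rd epsi).
by have [w] := knuth_wf k1 f'; rewrite f => -[<-].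
Qed.

Lemma bracketE (V : tab nu) x : same_component b x -> knuth (W x) (tword V) ->
  bracket V b = Some x.
Proof.
move=> bx k; rewrite /bracket; case: pickP => [psi /andP[iso /eqP hw]|/(_ lift_component)].
  congr Some; apply: knuth_component_inj => //.
    have /and5P[_ /forallP/(_ (psi V))/eqP <- _ _ _] := iso; exact: codom_f.
  exact: knuth_trans (iso_knuth V iso hw) (knuth_sym k).
by rewrite lift_component_iso lift_component_hw eqxx.
Qed.

End Component.

(** * The component of T (x) U *)

Lemma knuth_tword2 n (lam mu : n.-tuple nat) (hlam : sorted geq lam) (hmu : sorted geq mu)
    (T : tab lam) (U : tab mu) :
  knuth (rw (rows T) ++ rw (rows U)) (tword2 (T, U)).
Proof. by apply: knuth_cat; exact: knuth_rw_tword. Qed.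

(** When e_i acts on the first factor, the [weps] of that factor is positive and the result is not
    0. So at a highest weight element every e_i falls on the second factor and kills it. *)
Lemma tensor_highest n (lam mu : n.-tuple nat) (hlam : sorted geq lam) (hmu : sorted geq mu)
    (x : tensor (tab_crystal lam) (tab_crystal mu)) :
  highest_weight x -> x.2 = hw_tab mu /\
    forall i, weps i (rw (rows x.1) ++ rw (rows x.2)) = 0.
Proof.
case: x => [T U] /(highest_weightP (reading_tensor hlam hmu)) h /=; split.
  apply: hw_tabE => // i; rewrite (sc_eps (knuth_same_crystal (knuth_rw_tword hmu U))).
  apply/eqP; rewrite -we_None; have := h i; rewrite /tword2 we_cat /=.
  case: ifP => hi; last by case: (we i (tword U)).
  have : we i (tword T) <> None by move/eqP; rewrite we_None; lia.
  by case: (we i (tword T)).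
move=> i; rewrite (sc_eps (knuth_same_crystal (knuth_tword2 hlam hmu T U))); apply/eqP.
by rewrite -we_None h.
Qed.

Theorem theorem7p8 (n : nat) (lam mu : n.-tuple nat)
    (hlam : sorted geq lam) (hmu : sorted geq mu)
    (T : tab lam) (U : tab mu) :
  let B := tensor (tab_crystal lam) (tab_crystal mu) in
  let TU : B := (T, U) in
  gt_pattern lam (Rarray T U) /\
  exists R : tab lam,
    (forall i j, 1 <= j <= i -> i <= n -> gt R i j = Rarray T U i j) /\
    let b : B := (R, hw_tab mu) in
    (forall x : B, (same_component TU x && highest_weight x) = (x == b)) /\
    exists (nu : n.-tuple nat) (V : tab nu),
      sorted geq nu /\
      wt b = shape_weight nu /\
      is_rectification (star_inner lam) (star_filling T U) V /\
      bracket V b = Some TU.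
Proof.
move=> B TU; have rd := reading_tensor hlam hmu.
(* The array is constant on the component, and at a highest weight element it is the pattern of the
   first factor. *)
have highest_gt (x : B) : same_component TU x -> highest_weight x ->
    x.2 = hw_tab mu /\
    forall i j, 1 <= j <= i -> i <= n -> gt x.1 i j = Rarray T U i j.
  move=> cx hx; have [e hw] := tensor_highest hlam hmu hx; split=> // i j ji ni.
  rewrite (Rarray_component hlam hmu i j cx) e gtE; last by case/andP: ji.
  by rewrite e in hw; rewrite Rarray_hw.
have [[R y] cb hb] := exists_highest_weight rd TU.
have [/= ey gR] := highest_gt _ cb hb; subst y.
split.
  have [g1 g2] := gt_pattern_gt hlam R; split=> [r|i j ji ni].
    by rewrite -gR ?g1 //=.
  have [h1 h2] := g2 i j ji ni; rewrite -!gR //; lia.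
exists R; split; first exact: gR.
pose b : B := (R, hw_tab mu).
have uniq (x : B) : same_component TU x -> highest_weight x -> x = b.
  case: x => [R' y] cx hx; have [/= -> gR'] := highest_gt _ cx hx.
  congr pair; apply: gt_inj => // i j ji ni; by rewrite gR' // gR.
split=> [x|].
  apply/andP/eqP => [[]|->]; [exact: uniq | by split].
have bTU : same_component b TU by rewrite /same_component same_component_sym.
have uniq' (x : B) : same_component b x -> highest_weight x -> x = b.
  by move=> cx; apply: uniq; exact: connect_trans cb cx.
(* [V] is the insertion tableau of the word of T (x) U, and [nu] its shape, the same for every
   element of the component. *)
have [nu [V [hnu enu eV]]] := tab_of_rows (ntableau_ptab (rd_lt rd TU)).
have shape_b : map size (ptab n (tword2 b)) = nu.
  by rewrite enu; apply: (shape_component rd bTU).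
have kV : knuth (tword2 TU) (rw (rows V)).
  by rewrite eV; exact: knuth_sym (knuth_ptab _ _).
exists nu, V; split=> //; split; last split.
(* The word of [b] is Knuth equivalent to that of b_nu, in which the letter [k] occurs once for each
   cell of row [k]. *)
- apply/ffunP => k; rewrite -[LHS]/(wt b k) (rd_wt rd) ffunE; congr Posz.
  have kh := knuth_trans (knuth_rw_tword hnu _) (knuth_highest rd hnu shape_b hb).
  rewrite -(permP (sc_perm (knuth_same_crystal kh))) -hw_count.
    by rewrite nth_rows size_trow.
  by move=> r; rewrite nth_hw_rows size_nseq.
- apply: star_rectification => //.
  exact: knuth_trans (knuth_tword2 hlam hmu T U) kV.
- apply: (bracketE rd hnu shape_b hb uniq' bTU).
  exact: knuth_trans kV (knuth_rw_tword hnu V).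
Qed.
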